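(* Let $\Sigma$ be a $(d-1)$-dimensional pure shellable simplicial complex with face poset $P_\Sigma$, and let $S\subseteq[d-1]=\{1,\dots,d-1\}$. Then the order complex $\Delta((P_\Sigma)_S)$ of the rank-selected poset $(P_\Sigma)_S$ admits a convex-ear decomposition.
   Context: The face poset $P_\Sigma$ is the set of faces of $\Sigma$ (including $\emptyset$) ordered by inclusion; the rank of a face is its number of vertices, and $(P_\Sigma)_S$ is the subposet of elements whose rank lies in $S$. The order complex $\Delta(P)$ of a poset $P$ is the simplicial complex whose simplices are the chains of $P$. A pure simplicial complex is shellable if its facets can be ordered $F_1,\dots,F_t$ so that for each $1<i\le t$, $F_i\cap\bigcup_{j<i}F_j$ is a non-empty union of facets of $\partial F_i$. A $(d-1)$-dimensional simplicial complex $\Delta$ admits a convex-ear decomposition if there are subcomplexes $\Sigma_1,\dots,\Sigma_n$ such that: (i) $\bigcup_{i=1}^n\Sigma_i=\Delta$; (ii) $\Sigma_1$ is the boundary complex of a simplicial $d$-polytope, and for $i>1$, $\Sigma_i$ is a full-dimensional (i.e. $(d-1)$-dimensional) proper subcomplex of the boundary complex of some simplicial $d$-polytope; (iii) for $i>1$, $\Sigma_i$ is a simplicial ball; (iv) for $i>1$, $\left(\bigcup_{j=1}^{i-1}\Sigma_j\right)\cap\Sigma_i=\partial\Sigma_i$. (Here $d$ denotes one more than the dimension of the complex being decomposed; being a boundary complex, or subcomplex thereof, is meant up to isomorphism.) *)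

(* Defs.v *)
From HB Require Import structures.
From mathcomp Require Import all_boot all_order all_algebra.
From mathcomp Require Import all_classical all_reals all_analysis.

Set Implicit Arguments.
Unset Strict Implicit.
Unset Printing Implicit Defensive.

Import Order.TTheory GRing.Theory Num.Theory.
Import numFieldNormedType.Exports.
(* Orders {set T} by inclusion. *)
Export Order.DefaultSetSubsetOrder.

Local Open Scope ring_scope.

(* A finite abstract simplicial complex is a nonempty, downward closed family
   of finite sets; it therefore contains the empty face.  Elements of the
   ambient finite type need not be vertices of the complex. *)
Section Complexes.
Variable V : finType.
Implicit Types (F G H : {set V}) (K : {set {set V}}).

Definition is_complex K : Prop :=
  finset.set0 \in K /\
  (forall F G, F \in K -> G \subset F -> G \in K).

(* The dimension of K plus one. *)
Definition crank K : nat := \max_(F in K) #|F|.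

Definition facets K : {set {set V}} :=
  [set F | maxset (fun G : {set V} => G \in K) F]%SET.

Definition pure K : Prop := forall F, F \in facets K -> #|F| = crank K.

Definition vertices K : {set V} := [set v | [set v]%SET \in K]%SET.

Definition simplex_boundary F : {set {set V}} := (powerset F :\ F)%SET.

Definition shellable K : Prop :=
  exists s : seq {set V},
    [/\ uniq s, s =i facets K &
      forall i, (0 < i < size s)%N ->
        let Fi := nth finset.set0 s i in
        exists A : {set {set V}},
          [/\ A != finset.set0, A \subset facets (simplex_boundary Fi) &
              (powerset Fi :&:
                 \bigcup_(j < i) powerset (nth finset.set0 s j))%SET
              = (\bigcup_(G in A) powerset G)%SET]].

(* The boundary of a triangulated ball: the subcomplex generated by the
   codimension-one faces lying in exactly one facet. *)
Definition ball_boundary K : {set {set V}} :=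
  [set G : {set V} | [exists F : {set V},
     [&& G \subset F, #|F|.+1 == crank K &
         #|[set H in facets K | F \subset H]%SET| == 1%N]]]%SET.

End Complexes.

Section Posets.

Definition order_complex (disp : Order.disp_t) (T : finPOrderType disp)
    (P : {set T}) : {set {set T}} :=
  [set C : {set T} | (C \subset P) &&
     [forall x in C, forall y in C, (x >=< y)%O]]%SET.

Definition face_poset (V : finType) (K : {set {set V}}) : {set {set V}} := K.

(* The rank of a face in the face poset is its number of vertices. *)
Definition rank_selected (V : finType) (K : {set {set V}}) (S : {pred nat}) :
    {set {set V}} :=
  [set F in face_poset K | #|F| \in S]%SET.

End Posets.

Section Balls.
Variable R : realType.

Definition realization (V : finType) (K : {set {set V}}) : set {ptws V -> R} :=
  [set x | [/\ forall v, 0 <= x v, \sum_v x v = 1 &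
    exists2 F : {set V}, F \in K & forall v, x v != 0 -> v \in F]]%classic.

Definition homeomorphic (T U : topologicalType) (A : set T) (B : set U) : Prop :=
  exists (f : T -> U) (g : U -> T),
    [/\ {within A, continuous f}%classic, {within B, continuous g}%classic,
        forall x, A x -> B (f x) /\ g (f x) = x &
        forall y, B y -> A (g y) /\ f (g y) = y].

(* Spelled out since the library's balls in ['rV[R]_k] are those of the sup
   norm. *)
Definition euclidean_ball (k : nat) : set 'rV[R]_k :=
  [set x | \sum_i x 0 i ^+ 2 <= 1]%classic.

Definition simplicial_ball (V : finType) (K : {set {set V}}) : Prop :=
  exists k : nat, homeomorphic (realization K) (@euclidean_ball k).

End Balls.

Section Polytopes.
Variables (R : realType) (n : nat).
Implicit Types (X : seq 'rV[R]_n) (P F : set 'rV[R]_n).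

Definition convex_hull X : set 'rV[R]_n :=
  [set x | exists w : 'I_(size X) -> R,
     [/\ forall i, 0 <= w i, \sum_i w i = 1 &
         x = \sum_i w i *: X`_i]]%classic.

(* Points are lifted to height one, so that affine (in)dependence and affine
   dimension become linear. *)
Definition lift_points X : seq 'rV[R]_(1 + n) :=
  [seq row_mx (1%:M : 'M[R]_1) x | x <- X].

Definition polytope_of_dim (d : nat) P : Prop :=
  exists X, P = convex_hull X /\ (\dim <<lift_points X>>%VS = d.+1)%N.

(* Intersections with supporting hyperplanes; taking u = 0 yields P itself and
   the empty face. *)
Definition is_face P F : Prop :=
  exists (u : 'cV[R]_n) (c : R),
    (forall x, P x -> (x *m u) 0 0 <= c) /\
    F = [set x | P x /\ (x *m u) 0 0 = c]%classic.

Definition proper_face P F : Prop := is_face P F /\ F <> P.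

Definition is_vertex P (x : 'rV[R]_n) : Prop := is_face P [set x]%classic.

Definition is_simplex F : Prop :=
  exists X, free (lift_points X) /\ F = convex_hull X.

Definition simplicial_polytope (d : nat) P : Prop :=
  polytope_of_dim d P /\ (forall F, proper_face P F -> is_simplex F).

(* The boundary complex, as the family of vertex sets of proper faces. *)
Definition boundary_complex P : set (set 'rV[R]_n) :=
  [set A | exists2 F, proper_face P F &
     A = [set x | is_vertex P x /\ F x]]%classic.

Definition image_complex (V : finType) (p : V -> 'rV[R]_n)
    (K : {set {set V}}) : set (set 'rV[R]_n) :=
  [set A | exists2 F : {set V}, F \in K &
     A = [set x | exists2 v, v \in F & x = p v]]%classic.

End Polytopes.

Section ConvexEar.
Variable R : realType.

Definition is_polytope_boundary (d : nat) (V : finType) (K : {set {set V}}) :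
    Prop :=
  exists (n : nat) (P : set 'rV[R]_n) (p : V -> 'rV[R]_n),
    [/\ simplicial_polytope d P, {in vertices K &, injective p} &
        image_complex p K = boundary_complex P].

Definition is_proper_in_polytope_boundary (d : nat) (V : finType)
    (K : {set {set V}}) : Prop :=
  exists (n : nat) (P : set 'rV[R]_n) (p : V -> 'rV[R]_n),
    [/\ simplicial_polytope d P, {in vertices K &, injective p} &
        (image_complex p K `<` boundary_complex P)%classic].

Definition convex_ear_decomposition (V : finType) (K : {set {set V}}) (m : nat)
    (E : 'I_m.+1 -> {set {set V}}) : Prop :=
  let d := crank K in
  [/\ forall i, is_complex (E i),
      (\bigcup_i E i)%SET = K,
      is_polytope_boundary d (E ord0),
      forall i, i != ord0 ->
        crank (E i) = d /\ is_proper_in_polytope_boundary d (E i) &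
      forall i, i != ord0 ->
        simplicial_ball R (E i) /\
        ((\bigcup_(j < m.+1 | (j < i)%N) E j) :&: E i)%SET
          = ball_boundary (E i)].

Definition has_convex_ear_decomposition (V : finType) (K : {set {set V}}) :
    Prop :=
  exists (m : nat) (E : 'I_m.+1 -> {set {set V}}), convex_ear_decomposition K E.

End ConvexEar.

(* Main.v *)
Require Import Defs.
From mathcomp Require Import all_boot all_order all_fingroup all_algebra.
From mathcomp Require Import all_classical all_reals all_analysis.
From mathcomp Require Import zify ring lra.

Set Implicit Arguments.
Unset Strict Implicit.
Unset Printing Implicit Defensive.

Import Order.TTheory GRing.Theory Num.Theory.
Import numFieldNormedType.Exports.

(** Let F_0, F_1, ... be a shelling of Sigma.  A face of F_i is new, that is,
    contained in no earlier F_j, iff it contains the restriction R_i of F_i, so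
    label the vertices of F_i by 0, ..., d-1 with R_i on the largest labels.  A
    permutation y of the labels is read as a word; the sets of its first s
    letters, for s in S, form a maximal chain of the rank-selected poset
    ([chain_of]).

    The subgroup of the symmetric group generated by the adjacent transpositions
    of positions s-1 and s, for s in S, cuts the positions into runs.  Words that
    put the same letters into each run ([key]) form a class, and the chains of a
    class form the Coxeter complex of a product of symmetric groups, a join of
    barycentric subdivisions of boundaries of simplices.  It is polytopal: the
    sum of the |x_a - x_b| over the pairs a, b in a common run is a convex
    function whose domains of linearity are the cones of its fan, and the unit
    ball of this function is the polytope ([fan_polytope], [sphere_polytope]).

    Each chain C of F_i lies in the chain of exactly one word that increases
    except possibly at the ranks of C ([tight]).  Call a word admissible if
    its descents are in S and its last letter is not in R_i.  The ear of a
    pair (i, class) is generated by the chains of its admissible words.  Ears are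
    ordered by i, and for equal i by decreasing potential, the sum over the
    letters of the letter times the number of its run.  Exchanging two adjacent
    letters in decreasing order moves the larger one to the right, hence never
    lowers the potential, so the class of the tight word of C comes first among
    the classes of F_i that contain C ([potential_tight]).  Consequently every
    chain belongs to some ear, and a chain of an ear is in an earlier ear iff its
    tight word is not an admissible word of the class ([ear_oldP]).

    Within a class, admissibility is inherited by words with more inverted pairs
    ([admissible_ideal]): sorting runs towards decreasing order only lowers the
    last letter of a run and raises the first one.  If the tight word of C is
    admissible in the class, then so are all words of the class around C, and C
    is interior to the ear.  If not, a walk towards the tight word by adjacent
    exchanges leaves the admissible words at some ridge that contains C, and C is
    on the boundary ([gallery], [ear_boundaryP]).  So the old part of an ear is
    exactly its boundary.

    The class of the identity in F_0 consists of admissible words only and gives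
    the first sphere; every other ear misses a word of its class.  The ideal
    property then makes the union of the cones of the ear a region
    {height >= 0}, where the height is a maximum of minima of linear functions,
    each of which has derivative 1 along one and the same direction.  Shearing
    along that direction turns the region into a half-space, and the set of its
    rays into a hemisphere, which is a ball ([half_space_ball], [ear_ball]). *)

(** * Polytopes from complete simplicial fans *)

Section Hull.
Local Open Scope ring_scope.
Variables (R : realType) (n : nat).
Implicit Types (x : 'rV[R]_n) (u : 'cV[R]_n).

(** Weights indexed by the points of a finite family are easier to handle than
    weights indexed by positions in a sequence. *)
Lemma convex_hull_enumP (I : finType) (A : {set I}) (p : I -> 'rV[R]_n) x :
  convex_hull [seq p a | a <- enum A] x <->
  exists w : I -> R, [/\ forall a, 0 <= w a, forall a, a \notin A -> w a = 0,
    \sum_a w a = 1 & x = \sum_a w a *: p a].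
Proof.
set s := enum A.
have memA a : (a \in s) = (a \in A) by rewrite mem_enum.
have sumA (M : nmodType) (F : I -> M) : (forall a, a \notin A -> F a = 0) ->
    \sum_a F a = \sum_(a <- s) F a.
  move=> F0; rewrite big_enum [RHS]big_mkcond; apply: eq_bigr => a _.
  by case: ifPn => // /F0.
case es : s => [|a0 s'].
  have A0 a : a \notin A by rewrite -memA es.
  split=> [[w [_ w1 _]]|[w [_ w0 w1 _]]].
    by move: w1; rewrite big_ord0 => /esym/eqP; rewrite oner_eq0.
  by move: w1; rewrite big1 => [/esym/eqP|a _]; rewrite ?oner_eq0 ?w0.
rewrite -es; have us : uniq s by apply: enum_uniq.
split=> [[w [w0 w1 ->]]|[w [w0 wA w1 ->]]].
  pose W (i : nat) := if insub i is Some j then w j else 0.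
  have WE (i : 'I_(size [seq p a | a <- s])) : W i = w i by rewrite /W valK.
  pose w' a := if a \in A then W (index a s) else 0.
  have w'A a : a \notin A -> w' a = 0 by rewrite /w' => /negbTE ->.
  exists w'; split=> //.
  - by move=> a; rewrite /w' /W; case: ifP => // _; case: insubP.
  - rewrite sumA // (big_nth a0) -w1 (eq_bigr (W \o val)) => [|i _]; last by rewrite /= WE.
    rewrite -(big_mkord xpredT (fun i => W i)) size_map !big_nat.
    apply: eq_bigr => i /= lt.
    by rewrite /w' -memA mem_nth ?index_uniq.
  - rewrite sumA => [|a /w'A ->]; last by rewrite scale0r.
    rewrite (eq_bigr (fun i : 'I__ => W i *: [seq p a | a <- s]`_i)) => [|i _]; last by rewrite WE.
    rewrite -(big_mkord xpredT (fun i => W i *: [seq p a | a <- s]`_i)) size_map (big_nth a0) !big_nat.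
    apply: eq_bigr => i /= lt.
    by rewrite /w' -memA mem_nth ?index_uniq // (nth_map a0).
exists (fun i => w (nth a0 s i)); split=> //.
  rewrite -(big_mkord xpredT (fun i => w (nth a0 s i))) size_map.
  by rewrite -(big_nth a0 xpredT) -sumA.
rewrite -(big_mkord xpredT (fun i => w (nth a0 s i) *: [seq p a | a <- s]`_i)) size_map.
rewrite sumA => [|a /wA ->]; last by rewrite scale0r.
by rewrite (big_nth a0) !big_nat; apply: eq_bigr => i /= lt; rewrite (nth_map a0).
Qed.

Definition dot x u : R := (x *m u) 0 0.

Lemma dotZ k x u : dot (k *: x) u = k * dot x u.
Proof. by rewrite /dot -scalemxAl mxE. Qed.
Lemma dotN x u : dot (- x) u = - dot x u.
Proof. by rewrite /dot mulNmx mxE. Qed.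
Lemma dot0 u : dot 0 u = 0.
Proof. by rewrite /dot mul0mx mxE. Qed.
Lemma dot_sum (I : finType) (P : pred I) (p : I -> 'rV[R]_n) u :
  dot (\sum_(a | P a) p a) u = \sum_(a | P a) dot (p a) u.
Proof. by rewrite /dot mulmx_suml summxE. Qed.
Lemma dotBr x u v : dot x (u - v) = dot x u - dot x v.
Proof. by rewrite /dot mulmxBr !mxE. Qed.
Lemma dotZr k x u : dot x (k *: u) = k * dot x u.
Proof. by rewrite /dot -scalemxAr mxE. Qed.
Lemma dot_sumr (I : finType) (P : pred I) x (u : I -> 'cV[R]_n) :
  dot x (\sum_(a | P a) u a) = \sum_(a | P a) dot x (u a).
Proof. by rewrite /dot mulmx_sumr summxE. Qed.
End Hull.

(** A complete simplicial fan with rays [p a] and cones spanned by the [sigma y],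
    together with linear functions [u y] that support the point set at height 1
    exactly along [sigma y], yields a simplicial polytope.  The functionals of
    [dual] are dual bases; they give linear independence, and let [u y] be tilted
    so as to cut out any subset of [sigma y]. *)
Section FanPolytope.
Local Open Scope ring_scope.
Variables (R : realType) (n : nat) (V : finType) (Y : Type).
Variables (p : V -> 'rV[R]_n) (sigma : Y -> {set V}) (u : Y -> 'cV[R]_n).
Variables (Vx : {set V}) (K : {set {set V}}).
Hypothesis VxP : forall a, a \in Vx <-> exists y, a \in sigma y.
Hypothesis KP : forall C, C \in K <-> exists y, C \subset sigma y.
Hypothesis u_le1 : forall y a, a \in Vx -> dot (p a) (u y) <= 1.
Hypothesis u_eq1 : forall y a, a \in Vx -> dot (p a) (u y) = 1 <-> a \in sigma y.
Hypothesis cover : forall z : 'rV[R]_n, exists y (x : V -> R),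
  [/\ forall a, 0 <= x a, forall a, a \notin sigma y -> x a = 0
    & z = \sum_a x a *: p a].
Hypothesis dual : forall y a, a \in sigma y -> exists v : 'cV[R]_n,
  forall b, b \in sigma y -> dot (p b) v = (b == a)%:R.

Let q (o : option V) : 'rV[R]_n := if o is Some a then p a else 0.

(** The origin is included so that the hull is a point, and not empty, in
    dimension 0; in positive dimension it is interior to the hull of the rays. *)
Definition fan_hull : set 'rV[R]_n :=
  convex_hull [seq q o | o <- enum (None |: [set Some a | a in Vx])%SET].
Notation P := fan_hull.

Lemma sum_option (M : nmodType) (F : option V -> M) :
  \sum_o F o = F None + \sum_a F (Some a).
Proof.
rewrite (bigD1 None) //=; congr (_ + _).
rewrite (reindex_omap Some id) /=; last by case.
by apply: eq_bigl => a; rewrite eqxx.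
Qed.

Lemma mem_cone_points o : (o \in None |: [set Some a | a in Vx])%SET =
  if o is Some a then a \in Vx else true.
Proof.
rewrite !inE; case: o => //= a; apply/imsetP/idP => [[b h [->]]//|h].
by exists a.
Qed.

Lemma fan_hullP x : P x <-> exists w : V -> R,
  [/\ forall a, 0 <= w a, forall a, a \notin Vx -> w a = 0, \sum_a w a <= 1
    & x = \sum_a w a *: p a].
Proof.
rewrite /P; split=> [/convex_hull_enumP[w [w0 wA w1 ->]]|[w [w0 wA w1 ->]]].
  exists (w \o Some); split=> //=.
  - by move=> a ha; apply: wA; rewrite mem_cone_points.
  - by rewrite -w1 sum_option lerDr.
  - by rewrite sum_option /= scaler0 add0r.
apply/convex_hull_enumP.
exists (fun o => if o is Some a then w a else 1 - \sum_a w a); split.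
- by case=> // ; rewrite subr_ge0.
- by case=> [a|]; rewrite mem_cone_points // => /wA.
- by rewrite sum_option subrK.
- by rewrite sum_option /= scaler0 add0r.
Qed.

Definition subhull (t : {set V}) : set 'rV[R]_n :=
  [set x | exists w : V -> R, [/\ forall a, 0 <= w a, forall a, a \notin t -> w a = 0,
    \sum_a w a = 1 & x = \sum_a w a *: p a]]%classic.

Lemma fan_hull0 : P 0.
Proof.
apply/fan_hullP; exists (fun=> 0); split=> //; first by rewrite big1.
by rewrite big1 // => a _; rewrite scale0r.
Qed.

Lemma sum_delta (a : V) : \sum_b (b == a)%:R = 1 :> R.
Proof.
by rewrite (bigD1 a) //= eqxx big1 ?addr0 // => b /negbTE ->.
Qed.

Lemma sum_deltaZ (a : V) : \sum_b (b == a)%:R *: p b = p a.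
Proof.
by rewrite (bigD1 a) //= eqxx scale1r big1 ?addr0 // => b /negbTE ->; rewrite scale0r.
Qed.

Lemma fan_hull_pt a : a \in Vx -> P (p a).
Proof.
move=> aV; apply/fan_hullP; exists (fun b => (b == a)%:R); split=> [b|b bV||].
- exact: ler0n.
- by case: eqP bV => // ->; rewrite aV.
- by rewrite sum_delta.
- by rewrite sum_deltaZ.
Qed.

Lemma subhull_pt (t : {set V}) a : a \in t -> subhull t (p a).
Proof.
move=> aV; exists (fun b => (b == a)%:R); split=> [b|b bV||].
- exact: ler0n.
- by case: eqP bV => // ->; rewrite aV.
- by rewrite sum_delta.
- by rewrite sum_deltaZ.
Qed.

Lemma average_eq (w : V -> R) (f : V -> R) (c : R) :
  (forall a, 0 <= w a) -> (forall a, w a != 0 -> f a <= c) ->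
  \sum_a w a = 1 -> \sum_a w a * f a = c -> forall a, w a != 0 -> f a = c.
Proof.
move=> w0 fc w1 e a wa.
have : \sum_a w a * (c - f a) = 0.
  under eq_bigr do rewrite mulrBr.
  by rewrite sumrB -mulr_suml w1 mul1r e subrr.
move/eqP; rewrite psumr_eq0 => [/allP/(_ a (mem_index_enum _))|b _] /=.
  by rewrite mulf_eq0 (negbTE wa) /= subr_eq0 => /eqP.
have [->|wb] := eqVneq (w b) 0; first by rewrite mul0r.
by rewrite mulr_ge0 // subr_ge0 fc.
Qed.

(** A weighted average attains the bound [c] only if all its terms do; [0 < c]
    excludes any weight on the origin. *)
Lemma face_subhull v c : (forall x, P x -> dot x v <= c) -> 0 < c ->
  [set x | P x /\ dot x v = c]%classic = subhull [set a in Vx | dot (p a) v == c]%SET.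
Proof.
move=> le c0; apply/seteqP; split=> x /=.
  move=> [/fan_hullP[w [w0 wV w1 ->]]]; rewrite dot_sum.
  under eq_bigr do rewrite dotZ; move=> e.
  have wle a : w a != 0 -> dot (p a) v <= c.
    move=> wa; apply/le/fan_hull_pt; apply: contraTT wa => /wV ->; by rewrite eqxx.
  have ws : \sum_a w a = 1.
    apply/eqP; rewrite eq_le w1 /=.
    have : c <= (\sum_a w a) * c.
      rewrite -{1}e mulr_suml; apply: ler_sum => a _.
      have [->|wa] := eqVneq (w a) 0; first by rewrite !mul0r.
      by rewrite ler_wpM2l ?wle.
    by rewrite -{1}[c]mul1r ler_pM2r.
  exists w; split=> // a; rewrite !inE negb_and => /orP[/wV//|ne].
  apply: contraNeq ne => wa; apply/eqP; exact: (average_eq w0 wle ws e).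
move=> [w [w0 ws w1 ->]]; split.
  apply/fan_hullP; exists w; split=> // [a aV|]; last by rewrite w1.
  by apply: ws; rewrite inE (negbTE aV).
rewrite dot_sum -[RHS]mul1r -w1 mulr_suml; apply: eq_bigr => a _; rewrite dotZ.
have [->|wa] := eqVneq (w a) 0; first by rewrite !mul0r.
suff /setIdP[_ /eqP ->] : a \in [set a in Vx | dot (p a) v == c]%SET by [].
by apply: contraTT wa => /ws ->; rewrite eqxx.
Qed.

Lemma sigma_sub y : {subset sigma y <= Vx}.
Proof. by move=> a ay; apply/VxP; exists y. Qed.

(** The points of a proper face sum to a vector of some cone [sigma y].  On that
    vector [u y] is at most the number of points, and the functional of the face
    forces equality, so that [u y] is 1 at each of the points. *)
Lemma proper_face_sub F : proper_face P F ->
  exists y (t : {set V}), t \subset sigma y /\ F = subhull t.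
Proof.
move=> [[v [c [le' eF']]] ne].
have le x : P x -> dot x v <= c := le' x.
have eF : F = [set x | P x /\ dot x v = c]%classic := eF'.
move: ne; rewrite {}eF => ne {le' eF'}.
have c0 : 0 <= c by have := le _ fan_hull0; rewrite dot0.
have {c0} [c0|c0] := eqVneq c 0.
  case: ne; apply/seteqP; split=> [x []//|x Px]; split=> //.
  have le0 z : dot z v <= 0.
    have [y [w [w0 ws ->]]] := cover z; rewrite dot_sum; apply: sumr_le0 => a _.
    rewrite dotZ; have [/sigma_sub ay|/ws ->] := boolP (a \in sigma y); last by rewrite mul0r.
    by rewrite mulr_ge0_le0 // -c0; apply/le/fan_hull_pt.
  by rewrite c0; apply/eqP; rewrite eq_le le0 -oppr_le0 -dotN le0.
have {}c0 : 0 < c by have := le _ fan_hull0; rewrite dot0 le_eqVlt eq_sym (negbTE c0).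
rewrite face_subhull //; set t := [set a in Vx | _]%SET.
have [y [w [w0 ws e]]] := cover (\sum_(a in t) p a).
exists y, t; split=> //; apply/fintype.subsetP => a at_.
have tV b : b \in t -> b \in Vx by rewrite inE => /andP[].
have tc b : b \in t -> dot (p b) v = c by rewrite inE => /andP[_ /eqP].
have ev : \sum_(b in t) 1 <= \sum_b w b.
  have : \sum_(b in t) 1 * c <= \sum_b w b * c.
    have := congr1 (fun z => dot z v) e; rewrite !dot_sum => h.
    rewrite (eq_bigr (fun b => dot (p b) v)) => [|b /tc ->]; last by rewrite mul1r.
    rewrite h; apply: ler_sum => b _; rewrite dotZ.
    have [/sigma_sub ay|/ws ->] := boolP (b \in sigma y); last by rewrite !mul0r.
    by rewrite ler_wpM2l //; apply/le/fan_hull_pt.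
  by rewrite -!mulr_suml ler_pM2r.
have eu : \sum_(b in t) dot (p b) (u y) = \sum_b w b.
  rewrite -dot_sum e dot_sum; apply: eq_bigr => b _; rewrite dotZ.
  have [by_|/ws ->] := boolP (b \in sigma y); last by rewrite !mul0r.
  by rewrite (u_eq1 y (sigma_sub by_)).2 // mulr1.
have : \sum_(b in t) (1 - dot (p b) (u y)) == 0.
  rewrite eq_le; apply/andP; split; first by rewrite sumrB eu subr_le0.
  by apply: sumr_ge0 => b /tV bV; rewrite subr_ge0 u_le1.
rewrite psumr_eq0 => [/allP/(_ a (mem_index_enum _))/implyP/(_ at_)|b /tV bV]; last first.
  by rewrite subr_ge0 u_le1.
by rewrite subr_eq0 eq_sym => /eqP/(u_eq1 y (tV _ at_)).
Qed.

(** Tilt [u y] by a small multiple of the dual functionals of [sigma y :\: t]. *)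
Lemma subhull_face y (t : {set V}) : t \subset sigma y -> proper_face P (subhull t).
Proof.
move=> ts; have {}dual' : forall a, exists v : 'cV[R]_n, a \in sigma y ->
    forall b, b \in sigma y -> dot (p b) v = (b == a)%:R.
  move=> a; have [/dual[v hv]|_] := boolP (a \in sigma y); first by exists v.
  by exists 0.
have [v hv] := choice dual'.
pose g b := \sum_(a in sigma y :\: t) dot (p b) (v a).
pose de b := 1 - dot (p b) (u y).
(* small enough for every gap [de b] to absorb the tilt [e * g b] *)
pose e := (1 + \sum_(b in Vx :\: sigma y) `|g b| / de b)^-1.
have de0 b : b \in Vx :\: sigma y -> 0 < de b.
  rewrite inE => /andP[bs bV]; rewrite subr_gt0 lt_neqAle u_le1 // andbT.
  by apply: contra bs => /eqP/(u_eq1 y bV).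
have sum0 : 0 <= \sum_(b in Vx :\: sigma y) `|g b| / de b.
  by apply: sumr_ge0 => b /de0 h; rewrite divr_ge0 // ltW.
have e0 : 0 < e by rewrite invr_gt0; lra.
have eg b : b \in Vx :\: sigma y -> - (e * g b) < de b.
  move=> bs; have d0 := de0 _ bs; apply: (@le_lt_trans _ _ (e * `|g b|)).
    by rewrite -mulrN ler_wpM2l ?(ltW e0) // -normrN ler_norm.
  rewrite mulrC ltr_pdivrMr; last by lra.
  rewrite -ltr_pdivrMl // mulrC (bigD1 b) //=.
  have : 0 <= \sum_(i in Vx :\: sigma y | i != b) `|g i| / de i.
    by apply: sumr_ge0 => i /andP[/de0 h _]; rewrite divr_ge0 // ltW.
  lra.
pose uu := u y - e *: \sum_(a in sigma y :\: t) v a.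
have duu b : dot (p b) uu = dot (p b) (u y) - e * g b.
  by rewrite /uu dotBr dotZr dot_sumr.
have gs b : b \in sigma y -> g b = (b \notin t)%:R.
  move=> bs; rewrite /g (eq_bigr (fun a => (b == a)%:R)) => [|a]; last first.
    by rewrite inE => /andP[_ ay]; rewrite hv.
  have [bt|bt] := boolP (b \in t).
    by rewrite big1 // => a; rewrite inE => /andP[at_ _]; case: eqP at_ => // <-; rewrite bt.
  rewrite (bigD1 b) ?inE ?bt //= eqxx big1 ?addr0 // => a /andP[_].
  by rewrite eq_sym => /negbTE ->.
have val b : b \in Vx -> dot (p b) uu <= 1 /\ (dot (p b) uu = 1 <-> b \in t).
  move=> bV; have [bs|bs] := boolP (b \in sigma y).
    rewrite duu gs // (u_eq1 y bV).2 //; case: (b \in t) => /=; split; rewrite ?mulr0 ?mulr1 ?subr0 //.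
      lra.
    by split=> //; lra.
  have := eg b; rewrite inE bs bV => /(_ isT); rewrite /de duu => lt; split; first lra.
  by split=> [|bt]; [lra | move: bs; rewrite (fintype.subsetP ts)].
have le x : P x -> dot x uu <= 1.
  move=> /fan_hullP[w [w0 wV w1 ->]]; rewrite dot_sum; apply: le_trans w1.
  apply: ler_sum => a _; rewrite dotZ; have [/val[h _]|/wV ->] := boolP (a \in Vx).
    by rewrite ler_piMr.
  by rewrite mul0r.
have et : t = [set a in Vx | dot (p a) uu == 1]%SET.
  apply/setP => a; rewrite inE; have [aV|aV] /= := boolP (a \in Vx).
    by apply/idP/eqP => /(val a aV).2.
  by apply: contraNF aV => /(fintype.subsetP ts)/sigma_sub.
have eF : [set x | P x /\ dot x uu = 1]%classic = subhull t.
  by rewrite face_subhull // -et.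
split; first by exists uu, 1; split=> //; rewrite -eF.
move=> eP; have := fan_hull0; rewrite -eP -eF /= dot0 => -[_ /esym/eqP].
by rewrite oner_eq0.
Qed.

Lemma p_inj : {in Vx &, injective p}.
Proof.
move=> a b aV bV e; have [y ay] := (VxP a).1 aV.
have by_ : b \in sigma y by apply/(u_eq1 y bV); rewrite -e; apply/(u_eq1 y aV).
have [v hv] := dual ay; have := hv _ by_; rewrite -e hv // eqxx.
by case: (eqVneq b a) => [->//|_] /= /eqP; rewrite oner_eq0.
Qed.

Lemma subhull_simplex y (t : {set V}) : t \subset sigma y -> is_simplex (subhull t).
Proof.
move=> ts; exists [seq p a | a <- enum t]; split; last first.
  by apply/seteqP; split=> x /convex_hull_enumP.
have [a0|nex] := pickP (mem t); last first.
  rewrite (_ : enum t = [::]) ?nil_free //; apply/eqP; rewrite -size_eq0 -cardE.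
  by apply/eqP/eq_card0 => a; apply: nex.
move=> a0t; set s := enum t.
have us : uniq s by apply: enum_uniq.
have -> : lift_points [seq p a | a <- s] = [seq row_mx 1%:M (p a) | a <- s].
  by rewrite /lift_points -map_comp.
apply/freeP => k; rewrite /= => h i.
have hn : (i < size s)%N by rewrite /s -cardE.
pose a := nth a0 s i.
have as_ : a \in t by rewrite -mem_enum mem_nth.
have [v hv] := dual (fintype.subsetP ts _ as_).
have := congr1 (fun z : 'rV_(1 + n) => dot (rsubmx z) v) h.
rewrite linear_sum dot_sum linear0 dot0 (bigD1 i) //= linearZ /= (nth_map a0) // row_mxKr dotZ.
rewrite hv ?eqxx ?mulr1 ?(fintype.subsetP ts) // big1 ?addr0 // => j ji.
have hj : (j < size s)%N by rewrite /s -cardE.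
rewrite linearZ /= (nth_map a0) // row_mxKr dotZ hv; last first.
  by apply/(fintype.subsetP ts); rewrite -mem_enum mem_nth.
by rewrite nth_uniq // (inj_eq val_inj) (negbTE ji) mulr0.
Qed.

Lemma fan_hull_dim : polytope_of_dim n P.
Proof.
exists [seq q o | o <- enum (None |: [set Some a | a in Vx])%SET]; split=> //.
set X := lift_points _.
suff -> : <<X>>%VS = fullv by rewrite dimvf /dim /= mul1n.
apply/vspaceP => z; rewrite memvf.
have Xq o : (o \in None |: [set Some a | a in Vx])%SET -> row_mx 1%:M (q o) \in <<X>>%VS.
  move=> h; apply: memv_span; apply/mapP; exists (q o) => //.
  by apply/mapP; exists o => //; rewrite mem_enum.
have x0 : row_mx 1%:M 0 \in <<X>>%VS by apply: (Xq None); rewrite mem_cone_points.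
rewrite -[z]hsubmxK (_ : row_mx _ _ = lsubmx z 0 0 *: row_mx 1%:M 0 + row_mx 0 (rsubmx z)); last first.
  rewrite scale_row_mx add_row_mx scaler0 add0r addr0; congr row_mx.
  by apply/rowP => i; rewrite !mxE (ord1 i) eqxx mulr1.
rewrite memvD ?memvZ //.
have [y [w [w0 ws ->]]] := cover (rsubmx z).
have -> : row_mx 0 (\sum_a w a *: p a) =
   \sum_a w a *: (row_mx 1%:M (p a) - row_mx 1%:M 0) :> 'rV[R]_(1 + n).
  have E a : w a *: (row_mx 1%:M (p a) - row_mx 1%:M 0) = row_mx 0 (w a *: p a) :> 'rV[R]_(1 + n).
    by rewrite opp_row_mx add_row_mx subrr subr0 scale_row_mx scaler0.
  rewrite (eq_bigr _ (fun a _ => E a)) {E}.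
  apply/rowP => j; rewrite summxE mxE.
  case e : (fintype.split j) => [k|k].
    by rewrite mxE big1 // => a _; rewrite mxE e mxE.
  by rewrite summxE; apply: eq_bigr => a _; rewrite [RHS]mxE e.
apply: memv_suml => a _; have [/sigma_sub aV|/ws ->] := boolP (a \in sigma y).
  by apply/memvZ/memvB => //; apply: (Xq (Some a)); rewrite mem_cone_points.
by rewrite scale0r mem0v.
Qed.

Lemma is_vertex_subhull (t : {set V}) x : t \subset Vx -> subhull t x -> is_vertex P x ->
  exists2 a, a \in t & x = p a.
Proof.
move=> tV [w [w0 ws w1 ex]] [v [c [le e]]].
have Px : P x /\ dot x v = c by rewrite -[_ /\ _]/([set x | P x /\ dot x v = c]%classic x) -e.
have [a wa] : exists a, w a != 0.
  apply/existsP; apply: contra_eqT w1 => /existsPn h.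
  by rewrite big1 ?(eq_sym 0) ?oner_eq0 // => a _; apply/eqP; have := h a; rewrite negbK.
have wt b : w b != 0 -> b \in t by apply: contraNT => /ws ->.
exists a; first exact: wt.
have := @average_eq w (fun a => dot (p a) v) c w0 _ w1 _ a wa => h.
suff : [set x]%classic (p a) by move=> /= ->.
rewrite e /=; split; first by apply/fan_hull_pt/(fintype.subsetP tV)/wt.
apply: h => [b /wt/(fintype.subsetP tV)/fan_hull_pt/le//|].
by rewrite -Px.2 ex dot_sum; apply: eq_bigr => b _; rewrite dotZ.
Qed.

Lemma pt_is_vertex a : a \in Vx -> is_vertex P (p a).
Proof.
move=> /VxP[y ay].
have : [set a]%SET \subset sigma y by rewrite finset.sub1set.
move=> /subhull_face[f _]; rewrite /is_vertex.
rewrite (_ : [set p a]%classic = subhull [set a]%SET) //.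
apply/seteqP; split=> x /=; first by move=> ->; apply: subhull_pt; rewrite inE.
move=> [w [w0 ws w1 ->]].
have w' b : b != a -> w b = 0 by move=> ba; apply: ws; rewrite inE.
have wa : w a = 1 by rewrite -w1 (bigD1 a) //= big1 ?addr0.
rewrite (bigD1 a) //= wa scale1r big1 ?addr0 // => b /w' ->; by rewrite scale0r.
Qed.

Lemma vertices_subhull y (t : {set V}) : t \subset sigma y ->
  [set x | is_vertex P x /\ subhull t x]%classic =
  [set x | exists2 v, v \in t & x = p v]%classic.
Proof.
move=> ts; have tV : t \subset Vx by apply/fintype.subsetP => a /(fintype.subsetP ts)/sigma_sub.
apply/seteqP; split=> x /=; first by move=> [h1 h2]; apply: is_vertex_subhull.
by move=> [a at_ ->]; split; [apply/pt_is_vertex/(fintype.subsetP tV) | apply: subhull_pt].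
Qed.

Theorem fan_polytope : exists (P : set 'rV[R]_n),
  [/\ simplicial_polytope n P, {in Vx &, injective p} &
      image_complex p K = boundary_complex P].
Proof.
exists P; split; [split; [exact: fan_hull_dim|]|exact: p_inj|].
  by move=> F /proper_face_sub[y [t [ts ->]]]; apply: subhull_simplex ts.
apply/seteqP; split=> A /=.
  move=> [F /KP[y Fy] ->]; exists (subhull F); first exact: subhull_face Fy.
  by rewrite (vertices_subhull Fy).
move=> [F /proper_face_sub[y [t [ts ->]]] ->]; exists t; first by apply/KP; exists y.
by rewrite (vertices_subhull ts).
Qed.
End FanPolytope.

(** * Balls from piecewise linear half-spaces *)

Section Continuity.
Local Open Scope ring_scope.
Local Open Scope classical_set_scope.
Variable R : realType.

Lemma row_continuous_at (T : topologicalType) m (f : T -> 'I_m -> R) x :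
  (forall j, {for x, continuous (f ^~ j)}) ->
  {for x, continuous (fun t => \row_j f t j : 'rV[R]_m)}.
Proof.
move=> h; apply/cvg_ballP => e e0; rewrite /ball /= /mx_ball.
have : \forall t \near x, forall j, ball (f x j) e (f t j).
  by apply: filter_forall => j; move/cvg_ballP: (h j); apply.
by apply: filterS => t ht; split=> // i j; rewrite !mxE.
Qed.

Lemma ptws_continuous_at (T : topologicalType) (V : finType) (f : T -> V -> R) x :
  (forall v, {for x, continuous (f ^~ v)}) ->
  {for x, continuous (f : T -> {ptws V -> R})}.
Proof.
move=> h; apply/cvg_sup => v U [/= _ [[W /= oW <-] /= Wf]] /filterS; apply.
by apply: (h v); apply: open_nbhs_nbhs; split.
Qed.

Lemma sum_continuous_at (T : topologicalType) (I : Type) (s : seq I) (f : I -> T -> R) x :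
  (forall i, {for x, continuous (f i)}) ->
  {for x, continuous (fun t => \sum_(i <- s) f i t)}.
Proof.
move=> h; elim: s => [|i s IH].
  rewrite (_ : (fun t => _) = cst 0); first exact: cvg_cst.
  by apply/funext => t; rewrite big_nil.
rewrite (_ : (fun t => _) = (fun t => f i t + \sum_(i <- s) f i t)).
  by apply: cvgD => //; apply: h.
by apply/funext => t; rewrite big_cons.
Qed.

(** Continuity for the product topology, phrased so that it can be used with any
    family of continuous coordinates. *)
Definition contf (I : Type) (f : (I -> R) -> R) : Prop :=
  forall (T : topologicalType) (z : T -> I -> R) x,
    (forall i, {for x, continuous (z ^~ i)}) ->
    {for x, continuous (fun t => f (z t))}.

End Continuity.

(** The cone over [K] is carried by [comb], with inverse [lam], onto the region
    where [h] is nonnegative.  The pair made of [h] and of a projection along [c]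
    is a homogeneous homeomorphism of the space that takes this region to a
    half-space; the points of [K] are its rays, that is, the points of a
    hemisphere, which the projection flattens to a ball. *)
Section HalfSpaceBall.
Local Open Scope ring_scope.
Local Open Scope classical_set_scope.
Variables (R : realType) (V : finType) (K : {set {set V}}) (m : nat).
Variables (p : V -> 'I_m.+1 -> R) (lam : V -> ('I_m.+1 -> R) -> R).
Variables (h : ('I_m.+1 -> R) -> R) (c : 'I_m.+1 -> R).
Hypothesis lam_cont : forall a, contf (lam a).
Hypothesis h_cont : contf h.
Hypothesis h_hom : forall r z, 0 <= r -> h (fun i => r * z i) = r * h z.
Hypothesis h_shift : forall t z, h (fun i => z i + t * c i) = h z + t.
Hypothesis c0 : c ord0 != 0.

Definition in_cone (x : V -> R) : Prop := (forall a, 0 <= x a) /\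
  exists2 F : {set V}, F \in K & forall a, x a != 0 -> a \in F.
Definition comb (x : V -> R) (i : 'I_m.+1) : R := \sum_a x a * p a i.

Hypothesis cone_h : forall x, in_cone x -> 0 <= h (comb x).
Hypothesis cone_lam : forall x a, in_cone x -> lam a (comb x) = x a.
Hypothesis lam_cone : forall z, 0 <= h z -> in_cone (lam^~ z).
Hypothesis lam_comb : forall z, 0 <= h z -> comb (lam^~ z) = z.

Let proj (z : 'I_m.+1 -> R) (j : 'I_m) : R :=
  z (lift ord0 j) - z ord0 / c ord0 * c (lift ord0 j).
Let nrm2 z := h z ^+ 2 + \sum_j proj z j ^+ 2.
Let nrm z := Num.sqrt (nrm2 z).
Let hh (u : 'rV[R]_m) := Num.sqrt (1 - \sum_j u 0 j ^+ 2).
Let z0 (u : 'rV[R]_m) i := oapp (u 0) 0 (unlift ord0 i).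

(** The point of the hemisphere above [u], brought back by the inverse shear. *)
Let zof u i := z0 u i + (hh u - h (z0 u)) * c i.

Let proj_zof u j : proj (zof u) j = u 0 j.
Proof.
rewrite /proj /zof /z0 liftK unlift_none /=; field; exact: c0.
Qed.

Let h_zof u : h (zof u) = hh u.
Proof. by rewrite /zof h_shift; lra. Qed.

Let proj_hom r z j : proj (fun i => r * z i) j = r * proj z j.
Proof. by rewrite /proj; lra. Qed.

Let nrm2_hom r z : 0 <= r -> nrm2 (fun i => r * z i) = r ^+ 2 * nrm2 z.
Proof.
move=> r0; rewrite /nrm2 h_hom // exprMn mulrDr mulr_sumr; congr (_ + _).
by apply: eq_bigr => j _; rewrite proj_hom exprMn.
Qed.

Let nrm_hom r z : 0 <= r -> nrm (fun i => r * z i) = r * nrm z.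
Proof.
by move=> r0; rewrite /nrm nrm2_hom // sqrtrM ?sqr_ge0 // sqrtr_sqr ger0_norm.
Qed.

Let nrm2_ge0 z : 0 <= nrm2 z.
Proof. by rewrite addr_ge0 ?sqr_ge0 // sumr_ge0 // => j _; rewrite sqr_ge0. Qed.

Let coords_inj z z' : h z = h z' -> (forall j, proj z j = proj z' j) -> z = z'.
Proof.
move=> eh ep; pose t := (z ord0 - z' ord0) / c ord0.
have ez : z = fun i => z' i + t * c i.
  apply/funext => i; rewrite /t; case: (unliftP ord0 i) => [j|] ->; last by field.
  have := ep j; rewrite /proj => e.
  have -> : z (lift ord0 j) = z' (lift ord0 j) - z' ord0 / c ord0 * c (lift ord0 j)
     + z ord0 / c ord0 * c (lift ord0 j) by rewrite -e subrK.
  by field.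
suff t0 : t = 0 by rewrite ez t0; apply/funext => i; rewrite mul0r addr0.
by move: eh; rewrite ez h_shift; lra.
Qed.

Let h0 : h (fun=> 0) = 0.
Proof.
rewrite -[RHS](mul0r (h (fun=> 0))) -h_hom //.
by congr h; apply/funext => i; rewrite mul0r.
Qed.

Let nrm_eq0 z : nrm z = 0 -> z = fun=> 0.
Proof.
move/eqP; rewrite sqrtr_eq0 => le.
have s0 : 0 <= \sum_j proj z j ^+ 2 by apply: sumr_ge0 => j _; rewrite sqr_ge0.
have hz : 0 <= h z ^+ 2 by rewrite sqr_ge0.
have /eqP : h z ^+ 2 = 0 by rewrite /nrm2 in le; lra.
rewrite sqrf_eq0 => /eqP hz0.
have /eqP : \sum_j proj z j ^+ 2 = 0 by rewrite /nrm2 in le; lra.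
rewrite psumr_eq0 => [/allP e|j _]; last by rewrite sqr_ge0.
apply: coords_inj; first by rewrite hz0 h0.
move=> j; have := e j (mem_index_enum _); rewrite sqrf_eq0 => /eqP ->.
by rewrite /proj !mul0r subr0.
Qed.

Let f (x : {ptws V -> R}) : 'rV[R]_m := \row_j (proj (comb x) j / nrm (comb x)).
Let g (u : 'rV[R]_m) : {ptws V -> R} :=
  fun a => lam a (zof u) / \sum_b lam b (zof u).

Let comb_hom r (x : V -> R) : comb (fun a => r * x a) = fun i => r * comb x i.
Proof.
apply/funext => i; rewrite /comb mulr_sumr; apply: eq_bigr => a _; by rewrite mulrA.
Qed.

Let cone_hom r x : 0 <= r -> in_cone x -> in_cone (fun a => r * x a).
Proof.
move=> r0 [x0 [F FK xF]]; split; first by move=> a; rewrite mulr_ge0.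
by exists F => // a; rewrite mulf_eq0 negb_or => /andP[_]; apply: xF.
Qed.

Let real_cone x : realization K x -> in_cone x.
Proof. by move=> [x0 _ xF]. Qed.

Let nrm_gt0 x : realization K x -> 0 < nrm (comb x).
Proof.
move=> Kx; have cx := real_cone Kx; case: Kx => [_ x1 _].
rewrite lt_neqAle sqrtr_ge0 andbT eq_sym; apply: contra_eqN x1 => /eqP/nrm_eq0 e.
have cx0 := cone_hom (lexx 0) cx.
rewrite big1 ?(eq_sym 0) ?oner_eq0 // => a _.
have e0 : comb (fun a => 0 * x a) = fun=> 0.
  by rewrite comb_hom; apply/funext => i; rewrite mul0r.
by rewrite -(cone_lam a cx) e -e0 (cone_lam a cx0) mul0r.
Qed.

Let nrm_sq z : nrm z ^+ 2 = nrm2 z. Proof. by rewrite sqr_sqrtr. Qed.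

Let f_ball x : realization K x -> @euclidean_ball R m (f x).
Proof.
move=> Kx; have n0 := nrm_gt0 Kx; rewrite /euclidean_ball /= /f.
under eq_bigr do rewrite mxE expr_div_n.
rewrite -mulr_suml ler_pdivrMr ?exprn_gt0 // mul1r nrm_sq /nrm2 lerDr; exact: sqr_ge0.
Qed.

Let zof_f x : realization K x -> zof (f x) = fun i => (nrm (comb x))^-1 * comb x i.
Proof.
move=> Kx; have n0 := nrm_gt0 Kx; have r0 : 0 <= (nrm (comb x))^-1 by rewrite invr_ge0 ltW.
apply: coords_inj; last by move=> j; rewrite proj_zof proj_hom mxE mulrC.
rewrite h_zof h_hom // /hh.
under eq_bigr do rewrite mxE expr_div_n.
rewrite -mulr_suml.
have -> : 1 - (\sum_i proj (comb x) i ^+ 2) / nrm (comb x) ^+ 2 =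
   ((nrm (comb x))^-1 * h (comb x)) ^+ 2.
  have := nrm_sq (comb x); rewrite /nrm2 => e.
  have -> : \sum_i proj (comb x) i ^+ 2 = nrm (comb x) ^+ 2 - h (comb x) ^+ 2 by rewrite e; lra.
  by field; rewrite gt_eqF.
by rewrite sqrtr_sqr ger0_norm // mulr_ge0 // cone_h //; apply: real_cone.
Qed.

Let gf x : realization K x -> g (f x) = x.
Proof.
move=> Kx; have n0 := nrm_gt0 Kx; have r0 : 0 <= (nrm (comb x))^-1 by rewrite invr_ge0 ltW.
have cx := real_cone Kx.
have L a : lam a (zof (f x)) = (nrm (comb x))^-1 * x a.
  by rewrite zof_f // -comb_hom cone_lam //; apply: cone_hom.
apply/funext => a; rewrite /g L; under eq_bigr do rewrite L.
rewrite -mulr_sumr; case: Kx => [_ -> _]; rewrite mulr1.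
by field; rewrite gt_eqF.
Qed.

Let nrm_zof u : @euclidean_ball R m u -> nrm (zof u) = 1.
Proof.
rewrite /euclidean_ball /= => hu; rewrite /nrm /nrm2 h_zof /hh sqr_sqrtr ?subr_ge0 //.
by under [X in _ + X]eq_bigr do rewrite proj_zof; rewrite subrK sqrtr1.
Qed.

Let lam_sum_gt0 u : @euclidean_ball R m u -> 0 < \sum_b lam b (zof u).
Proof.
move=> hu; have hz : 0 <= h (zof u) by rewrite h_zof sqrtr_ge0.
have [l0 _] := lam_cone hz.
rewrite lt_neqAle sumr_ge0 ?andbT // eq_sym; apply/negP.
rewrite psumr_eq0 // => /allP e.
have : zof u = fun=> 0.
  rewrite -(lam_comb hz); apply/funext => i; rewrite /comb big1 // => a _.
  by have := e a (mem_index_enum _) => /= /eqP ->; rewrite mul0r.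
have := nrm_zof hu => + z; rewrite z /nrm /nrm2 h0 expr0n add0r big1 => [|j _]; last first.
  by rewrite /proj !mul0r subr0 expr0n.
by rewrite sqrtr0 => /esym/eqP; rewrite oner_eq0.
Qed.

Let g_real u : @euclidean_ball R m u -> realization K (g u).
Proof.
move=> hu; have s0 := lam_sum_gt0 hu.
have hz : 0 <= h (zof u) by rewrite h_zof sqrtr_ge0.
have [l0 [F FK lF]] := lam_cone hz; split.
- by move=> a; rewrite /g divr_ge0 // ltW.
- by rewrite /g -mulr_suml divff // gt_eqF.
- by exists F => // a; rewrite /g mulf_eq0 negb_or => /andP[/lF].
Qed.

Let fg u : @euclidean_ball R m u -> f (g u) = u.
Proof.
move=> hu; have s0 := lam_sum_gt0 hu.
have hz : 0 <= h (zof u) by rewrite h_zof sqrtr_ge0.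
have r0 : 0 <= (\sum_b lam b (zof u))^-1 by rewrite invr_ge0 ltW.
have e : comb (g u) = fun i => (\sum_b lam b (zof u))^-1 * zof u i.
  transitivity (comb (fun a => (\sum_b lam b (zof u))^-1 * lam a (zof u))).
    by congr comb; apply/funext => a; rewrite /g mulrC.
  by rewrite comb_hom lam_comb.
apply/matrix.rowP => j; rewrite mxE e nrm_hom // nrm_zof // proj_hom proj_zof.
by field; rewrite gt_eqF.
Qed.

Let proj_cont j : contf (fun z => proj z j).
Proof.
move=> T z x hz; apply: cvgB; first exact: hz.
by apply: cvgM; [apply: cvgM; [exact: hz|exact: cvg_cst]|exact: cvg_cst].
Qed.

Let sqr_cont (T : topologicalType) (k : T -> R) x :
  {for x, continuous k} -> {for x, continuous (fun t => k t ^+ 2)}.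
Proof. by move=> hk; apply: cvgM. Qed.

Let sqrt_cont (T : topologicalType) (k : T -> R) x :
  {for x, continuous k} -> {for x, continuous (fun t => Num.sqrt (k t))}.
Proof. by move=> hk; apply: (continuous_comp hk); apply: sqrt_continuous. Qed.

Let nrm_cont : contf nrm.
Proof.
move=> T z x hz; apply: sqrt_cont; apply: cvgD.
  by apply: sqr_cont; apply: h_cont.
by apply: sum_continuous_at => j; apply: sqr_cont; apply: proj_cont.
Qed.

Let comb_cont i : contf (fun x : V -> R => comb x i).
Proof.
move=> T z x hz; apply: sum_continuous_at => a.
by apply: cvgM; [exact: hz|exact: cvg_cst].
Qed.

Let f_cont x : realization K x -> {for x, continuous f}.
Proof.
move=> Kx; have n0 := nrm_gt0 Kx.
have pc (a : V) : {for x, continuous (fun y : {ptws V -> R} => y a)}.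
  by apply: (@proj_continuous V (fun=> R) a).
have cc i : {for x, continuous (fun y : {ptws V -> R} => comb y i)}.
  exact: (comb_cont (z := fun y : {ptws V -> R} => y)).
have k1 : {for x, continuous (fun y : {ptws V -> R} => nrm (comb y))}.
  exact: (nrm_cont (z := fun y : {ptws V -> R} => comb y)).
have k2 j : {for x, continuous (fun y : {ptws V -> R} => proj (comb y) j)}.
  exact: (proj_cont (z := fun y : {ptws V -> R} => comb y)).
have k3 : {for x, continuous (fun y : {ptws V -> R} => (nrm (comb y))^-1)}.
  by apply: (cvgV _ k1); rewrite gt_eqF.
apply: (row_continuous_at (f := fun (y : {ptws V -> R}) j => proj (comb y) j / nrm (comb y))) => j.
exact: (cvgM (k2 j) k3).
Qed.

Let g_cont u : @euclidean_ball R m u -> {for u, continuous g}.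
Proof.
move=> hu; have s0 := lam_sum_gt0 hu; apply: ptws_continuous_at => a.
have uc j : {for u, continuous (fun w : 'rV[R]_m => w 0 j)} by apply: coord_continuous.
have z0c i : {for u, continuous (fun w : 'rV[R]_m => z0 w i)}.
  by rewrite /z0; case: (unlift ord0 i) => [j|] /=; [exact: uc|exact: cst_continuous].
have zc i : {for u, continuous (fun w : 'rV[R]_m => zof w i)}.
  have hc : {for u, continuous (fun w : 'rV[R]_m => h (z0 w))} by exact: (h_cont (z := z0)).
  have sc : {for u, continuous (fun w : 'rV[R]_m => hh w)}.
    have s2 : {for u, continuous (fun w : 'rV[R]_m => \sum_j w 0 j ^+ 2)}.
      by apply: sum_continuous_at => j; apply: (sqr_cont (uc j)).
    exact: (sqrt_cont (cvgB (cvg_cst _) s2)).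
  exact: (cvgD (z0c i) (cvgM (cvgB sc hc) (cvg_cst _))).
have lc b : {for u, continuous (fun w : 'rV[R]_m => lam b (zof w))}.
  exact: (lam_cont (z := zof)).
have ic : {for u, continuous (fun w : 'rV[R]_m => (\sum_b lam b (zof w))^-1)}.
  apply: (cvgV _ (sum_continuous_at (f := fun b w => lam b (zof w)) lc)).
  by rewrite gt_eqF.
exact: (cvgM (lc a) ic).
Qed.

Theorem half_space_ball : simplicial_ball R K.
Proof.
exists m, f, g; split.
- by apply: continuous_in_subspaceT => x; rewrite inE => /f_cont.
- by apply: continuous_in_subspaceT => u; rewrite inE => /g_cont.
- by move=> x Kx; split; [exact: f_ball|exact: gf].
- by move=> u hu; split; [exact: g_real|exact: fg].
Qed.

End HalfSpaceBall.

Section Levels.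
Local Open Scope ring_scope.
Variables (R : realType) (n : nat) (c : 'I_n -> R).

(** Unit speed along [c] makes the shear that takes such a function as a new
    coordinate invertible, and it survives minima and maxima. *)
Definition level (f : ('I_n -> R) -> R) : Prop :=
  [/\ contf f, forall r z, 0 <= r -> f (fun i => r * z i) = r * f z
    & forall t z, f (fun i => z i + t * c i) = f z + t].

Lemma contf_min I (f g : (I -> R) -> R) : contf f -> contf g ->
  contf (fun z => Num.min (f z) (g z)).
Proof.
move=> cf cg T z x hz.
exact: (continuous_min (cf T z x hz) (cg T z x hz)).
Qed.

Lemma contf_max I (f g : (I -> R) -> R) : contf f -> contf g ->
  contf (fun z => Num.max (f z) (g z)).
Proof.
move=> cf cg T z x hz.
exact: (continuous_max (cf T z x hz) (cg T z x hz)).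
Qed.

Lemma contf_sum I (J : Type) (s : seq J) (P : pred J) (f : J -> (I -> R) -> R) :
  (forall j, contf (f j)) -> contf (fun z => \sum_(j <- s | P j) f j z).
Proof.
move=> cf T z x hz;
rewrite (_ : (fun t => _) = fun t => \sum_(j <- s) (if P j then f j (z t) else 0)); last first.
  by apply/funext => t; rewrite big_mkcond.
apply: (sum_continuous_at (f := fun j t => if P j then f j (z t) else 0)) => j.
by case: (P j); [exact: cf | exact: cst_continuous].
Qed.

Lemma level_min f g : level f -> level g -> level (fun z => Num.min (f z) (g z)).
Proof.
move=> [cf hf sf] [cg hg sg]; split; first exact: contf_min.
  by move=> r z r0; rewrite hf // hg // minr_pMr.
by move=> t z; rewrite sf sg addr_minl.
Qed.

Lemma level_max f g : level f -> level g -> level (fun z => Num.max (f z) (g z)).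
Proof.
move=> [cf hf sf] [cg hg sg]; split; first exact: contf_max.
  by move=> r z r0; rewrite hf // hg // maxr_pMr.
by move=> t z; rewrite sf sg addr_maxl.
Qed.

Lemma big_closed (Q : (('I_n -> R) -> R) -> Prop) (op : R -> R -> R)
    (opQ : forall f g, Q f -> Q g -> Q (fun z => op (f z) (g z)))
    (J : Type) (s : seq J) (P : pred J) f0 (f : J -> ('I_n -> R) -> R) :
  Q f0 -> (forall j, P j -> Q (f j)) -> Q (fun z => \big[op/f0 z]_(j <- s | P j) f j z).
Proof.
move=> l0 lf; elim: s => [|j s IH].
  by rewrite (_ : (fun z => _) = f0) //; apply/funext => z; rewrite big_nil.
rewrite (_ : (fun z => _) = fun z => if P j then op (f j z) (\big[op/f0 z]_(j <- s | P j) f j z)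
   else \big[op/f0 z]_(j <- s | P j) f j z); last by apply/funext => z; rewrite big_cons.
by have [/lf h|_] := boolP (P j); [apply: opQ | exact: IH].
Qed.

End Levels.

(** * Words and the chains of their prefixes *)

Section Runs.
Variable S : pred nat.

(** Positions p and p+1 are in the same run when p+1 is in [S]; runs are numbered
    from the left. *)
Fixpoint run (p : nat) : nat :=
  if p is p'.+1 then (run p' + (p \notin S))%N else 0%N.

Lemma leq_run p q : (p <= q)%N -> (run p <= run q)%N.
Proof.
move=> /subnK <-; elim: (q - p)%N => [|n IH] //.
by rewrite addSn /=; apply: leq_trans IH _; rewrite leq_addr.
Qed.

Lemma run_in p : p.+1 \in S -> run p.+1 = run p.
Proof. by move=> h /=; rewrite h addn0. Qed.

Lemma run_between p q r : (p < r)%N -> (r <= q)%N -> run p = run q -> r \in S.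
Proof.
case: r => // r pr rq e; apply: contraT => rS.
have := leq_run pr; have := leq_run rq.
rewrite /= rS -e addn1 => h1.
have := leq_run pr; rewrite ltnS in pr; have := leq_run pr; lia.
Qed.

Lemma run_cut p q : q = p.+1 -> q \notin S -> run q = (run p).+1.
Proof. by move=> -> /= ->; rewrite addn1. Qed.

Fixpoint run_start (p : nat) : nat :=
  if p is p'.+1 then (if p \in S then run_start p' else p) else 0%N.

Lemma run_start_le p : (run_start p <= p)%N.
Proof. by elim: p => //= p IH; case: ifP => // _; apply: leq_trans IH _. Qed.

Lemma run_run_start p : run (run_start p) = run p.
Proof.
elim: p => [|p IH] //=; case: ifP => /= [h|->//]; by rewrite addn0.
Qed.

Lemma run_start_eq p q : run p = run q -> run_start p = run_start q.
Proof.
wlog pq : p q / (p <= q)%N.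
  by move=> h e; case: (leqP p q) => [/h->//|/ltnW/h<-].
elim: q pq => [|q IH]; first by rewrite leqn0 => /eqP ->.
rewrite leq_eqVlt => /orP[/eqP -> //|pq e].
have qS := run_between pq (leqnn _) e.
by rewrite /= qS; apply: IH => //; rewrite e run_in.
Qed.

Lemma run_start_notin p : 0%N \notin S -> run_start p \notin S.
Proof. by move=> S0; elim: p => [|p IH] //=; case: ifP => // ->. Qed.

Lemma run_start_id p : p \notin S -> run_start p = p.
Proof. by case: p => //= p /negbTE ->. Qed.

End Runs.

Section RunInduction.
Variables (d : nat) (S : pred nat).

Lemma run_ind (r : 'I_d -> 'I_d -> Prop) : (forall p, r p p) ->
  (forall p q s, r p q -> r q s -> r p s) ->
  (forall p q : 'I_d, q = p.+1 :> nat -> (q : nat) \in S -> r p q) ->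
  forall p q : 'I_d, (p <= q)%N -> run S p = run S q -> r p q.
Proof.
move=> rr rt ra p q; case: q => q qd /=; elim: q qd => [|q IH] qd.
  by rewrite leqn0 => /eqP e _; rewrite (_ : p = Ordinal qd) //; apply: val_inj.
rewrite leq_eqVlt => /orP[/eqP e _|pq e].
  by rewrite (_ : p = Ordinal qd) //; apply: val_inj.
have qS := run_between pq (leqnn _) e.
apply: (rt _ (Ordinal (ltnW qd))); last by apply: ra.
apply: IH => //; by rewrite e run_in.
Qed.
End RunInduction.

Section Words.
Variables (V : finType) (d : nat) (S : pred nat) (phi : 'I_d -> V).
Hypothesis phi_inj : injective phi.
Implicit Types (y z : {perm 'I_d}) (a b p q r : 'I_d) (C : {set {set V}}).

Definition pos y a : nat := (y^-1)%g a.

Lemma pos_perm y p : pos y (y p) = p.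
Proof. by rewrite /pos permK. Qed.

Lemma pos_inj y : injective (pos y).
Proof. by move=> a b /ord_inj/perm_inj. Qed.

Lemma pos_lt y a : (pos y a < d)%N. Proof. exact: ltn_ord. Qed.

Lemma posP y a : exists2 p, a = y p & pos y a = p.
Proof. by exists ((y^-1)%g a); rewrite ?permKV. Qed.

Definition pref y (s : nat) : {set V} := [set phi a | a : 'I_d & (pos y a < s)%N].

Lemma mem_pref y s a : (phi a \in pref y s) = (pos y a < s)%N.
Proof.
apply/imsetP/idP => [[b]|h]; last by exists a; rewrite ?inE.
by rewrite inE => h /phi_inj ->.
Qed.

Lemma pref_sub y s : pref y s \subset [set phi a | a : 'I_d].
Proof. by apply/fintype.subsetP => _ /imsetP[a _ ->]; apply: imset_f. Qed.

Lemma card_ord_lt s : (s <= d)%N -> #|[set p : 'I_d | (p < s)%N]| = s.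
Proof.
move=> sd; rewrite -sum1dep_card -(big_ord_widen d (fun _ => 1%N) sd).
by rewrite sum1_card card_ord.
Qed.

Lemma card_pos_lt y s : (s <= d)%N -> #|[set a | (pos y a < s)%N]| = s.
Proof.
move=> sd; rewrite -[RHS](card_ord_lt sd) -[RHS](card_imset _ (@perm_inj _ y)).
apply: eq_card => a; apply/idP/imsetP => [|[p]]; rewrite !inE.
  by move=> h; exists ((y^-1)%g a); rewrite ?inE ?permKV.
by move=> h ->; rewrite pos_perm.
Qed.

Lemma card_pref y s : (s <= d)%N -> #|pref y s| = s.
Proof. by move=> sd; rewrite card_imset // -[RHS](card_pos_lt y sd) cardsE. Qed.

Definition chain_of y : {set {set V}} :=
  [set pref y (s : nat) | s : 'I_d & (s : nat) \in S].

Lemma mem_chain_of y (s : 'I_d) : (s : nat) \in S -> pref y s \in chain_of y.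
Proof. by move=> h; apply/imsetP; exists s; rewrite ?inE. Qed.

Lemma chain_ofP y A : reflect (exists2 s : 'I_d, (s : nat) \in S & A = pref y s)
  (A \in chain_of y).
Proof.
apply: (iffP imsetP) => [[s]|[s h ->]]; last by exists s; rewrite ?inE.
by rewrite inE => h ->; exists s.
Qed.

Lemma pref_inj2 y z (s t : 'I_d) : pref y s = pref z t -> s = t.
Proof.
by move=> /(congr1 (fun A : {set V} => #|A|)); rewrite !card_pref; [apply: val_inj|exact: ltnW..].
Qed.

Lemma pref_inj y (s t : 'I_d) : pref y s = pref y t -> s = t.
Proof. exact: pref_inj2. Qed.

Lemma card_chain_of y : #|chain_of y| = #|[set s : 'I_d | (s : nat) \in S]|.
Proof. by rewrite card_in_imset // => s t _ _; apply: pref_inj. Qed.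

(** Two words have the same key iff they differ by permutations within the
    runs. *)
Definition key y : {ffun 'I_d -> nat} := [ffun a => run S (pos y a)].

Lemma keyE y a : key y a = run S (pos y a). Proof. by rewrite ffunE. Qed.
Lemma key_perm y p : key y (y p) = run S p. Proof. by rewrite keyE pos_perm. Qed.

(** A rank outside [S] separates two runs. *)
Lemma pref_key y z (s : nat) : key y = key z -> s \notin S -> pref y s = pref z s.
Proof.
move=> e sS.
suff H u a : (pos u a < s)%N = (run S (pos u a) < run S s)%N.
  apply/setP => v; apply/imsetP/imsetP => -[a].
    by rewrite inE H -keyE e keyE -H => h ->; exists a; rewrite ?inE.
  by rewrite inE H -keyE -e keyE -H => h ->; exists a; rewrite ?inE.
case: ltnP => [h|h]; last by apply/esym/negbTE; rewrite -leqNgt leq_run.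
apply/esym; rewrite ltn_neqAle leq_run ?(ltnW h)// andbT.
by apply: contra sS => /eqP e'; apply: run_between h (leqnn _) e'.
Qed.

Lemma eq_prefs y z : (forall s : 'I_d, pref y s = pref z s) -> y = z.
Proof.
move=> h; apply: invg_inj; apply/permP => a; apply: ord_inj.
have H u v : (forall s : 'I_d, pref u s = pref v s) -> (pos u a <= pos v a)%N.
  move=> {}h; case: (leqP (pos u a) (pos v a)) => // lt.
  by have := mem_pref v ((u^-1)%g a) a; rewrite -h mem_pref ltnn => /esym; rewrite lt.
by apply/eqP; rewrite eqn_leq; apply/andP; split; apply: H.
Qed.

Lemma chain_of_inj y z : key y = key z -> chain_of z \subset chain_of y -> y = z.
Proof.
move=> e sub; apply: eq_prefs => s.
have [sS|sS] := boolP ((s : nat) \in S); last exact: pref_key.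
have /(fintype.subsetP sub)/chain_ofP[t tS et] := mem_chain_of z sS.
by rewrite et (pref_inj2 et).
Qed.

(** The letters of the restriction of a facet are those that are at least
    [rho]; an increasing last block meets them iff its last letter does. *)
Definition admissible (rho : nat) y : bool :=
  [forall p : 'I_d, forall q : 'I_d,
     ((q : nat) == p.+1) ==> ((q : nat) \notin S) ==> (y p < y q)%N]
  && [forall p : 'I_d, (p.+1 == d) ==> (y p < rho)%N].

Lemma admissibleP rho y :
  reflect ((forall p q, q = p.+1 :> nat -> (q : nat) \notin S -> (y p < y q)%N) /\
           (forall p, p.+1 = d -> (y p < rho)%N)) (admissible rho y).
Proof.
apply: (iffP andP) => -[h1 h2]; split.
- move=> p q e qS; move/forallP/(_ p)/forallP/(_ q)/implyP: h1.
  by move=> /(_ (introT eqP e))/implyP/(_ qS).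
- by move=> p e; move/forallP/(_ p)/implyP: h2; apply; apply/eqP.
- by do 2!apply/forallP => ?; apply/implyP => /eqP e; apply/implyP => qS; apply: h1.
- by apply/forallP => ?; apply/implyP => /eqP; apply: h2.
Qed.

(** Admissibility compares last letters of runs with first letters of later runs,
    and bounds the last letter of the last run.  Inverting more pairs within the
    runs lowers last letters and raises first letters. *)
Lemma admissible_ideal rho y z : admissible rho y -> key z = key y ->
  (forall a b, (b < a)%N -> key y a = key y b ->
     (pos z b < pos z a)%N -> (pos y b < pos y a)%N) ->
  admissible rho z.
Proof.
move=> /admissibleP[g1 g2] ek inv.
have lastP p : (forall q, q = p.+1 :> nat -> (q : nat) \notin S) -> (z p <= y p)%N.
  move=> pl; rewrite leqNgt; apply/negP => lt.
  have maxp r : run S r = run S p -> (r <= p)%N.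
    move=> e; rewrite leqNgt; apply/negP => pr.
    have ps : (p.+1 < d)%N by apply: leq_ltn_trans pr (ltn_ord r).
    by have := pl (Ordinal ps) erefl; rewrite (run_between (ltnSn p) pr (esym e)).
  have ez : key y (z p) = run S p by rewrite -ek key_perm.
  have ey : key z (y p) = run S p by rewrite ek key_perm.
  have := inv _ _ lt; rewrite ez key_perm pos_perm => /(_ erefl).
  have [r e1 e2] := posP z (y p); have [s e3 e4] := posP y (z p).
  move: ez ey; rewrite !keyE !pos_perm e2 e4 => ez ey.
  have := maxp _ ez; have := maxp _ ey => h1 h2.
  suff /eqP : r != p :> nat by lia.
  by apply: contraTneq lt => /val_inj e; rewrite e1 e ltnn.
have firstP q : (q : nat) \notin S -> (y q <= z q)%N.
  move=> qS; rewrite leqNgt; apply/negP => lt.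
  have minq r : run S r = run S q -> (q <= r)%N.
    by move=> e; rewrite leqNgt; apply: contra qS => rq; apply: run_between rq (leqnn _) e.
  have ez : key y (z q) = run S q by rewrite -ek key_perm.
  have ey : key z (y q) = run S q by rewrite ek key_perm.
  have := inv _ _ lt; rewrite ez key_perm pos_perm => /(_ erefl).
  have [r e1 e2] := posP z (y q); have [s e3 e4] := posP y (z q).
  move: ez ey; rewrite !keyE !pos_perm e2 e4 => ez ey.
  have := minq _ ez; have := minq _ ey => h1 h2.
  suff /eqP : r != q :> nat by lia.
  by apply: contraTneq lt => /val_inj e; rewrite e1 e ltnn.
apply/admissibleP; split=> [p q e qS|p e].
  apply: leq_ltn_trans (leq_trans (g1 _ _ e qS) (firstP _ qS)).
  by apply: lastP => q' e'; rewrite e' -e.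
apply: leq_ltn_trans (g2 _ e); apply: lastP => q eq.
by have := ltn_ord q; rewrite eq e ltnn.
Qed.

(** The word that lists increasingly what each member of [C] adds to the previous
    ones; among the words of [C] it has the fewest inversions. *)
Definition tight C y : Prop := C \subset chain_of y /\
  (forall p q, q = p.+1 :> nat -> pref y q \notin C -> (y p < y q)%N).

Lemma tight_incr C y p q : tight C y -> (p < q)%N ->
  (forall r, (p < r)%N -> (r <= q)%N -> pref y r \notin C) -> (y p < y q)%N.
Proof.
move=> [_ t]; case: q => q qd /=; elim: q qd => // q IH qd pq h.
have qd' : (q < d)%N := ltnW qd.
have last : (y (Ordinal qd') < y (Ordinal qd))%N.
  by apply: t => //; apply: h.
move: pq; rewrite ltnS leq_eqVlt => /orP[/eqP e|pq].
  by rewrite (_ : p = Ordinal qd') //; apply: val_inj.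
apply: ltn_trans last; apply: IH => // r pr rq; apply: h => //=.
exact: leq_trans rq _.
Qed.

Lemma tight_sep C y a b : tight C y -> (pos y a < pos y b)%N -> (b < a)%N ->
  exists2 A, A \in C & (phi a \in A) && (phi b \notin A).
Proof.
move=> ty; have [p -> ->] := posP y a; have [q -> ->] := posP y b => pq ba.
case: (pickP (fun r => [&& (p < r)%N, (r <= q)%N & pref y r \in C])) => [r /and3P[h1 h2 h3]|h].
  by exists (pref y r) => //; rewrite !mem_pref !pos_perm h1 -leqNgt.
have := tight_incr ty pq; rewrite ltnNge ltnW // => f.
suff: false by []; apply: f => r h1 h2; apply/negP => h3.
by have := h r; rewrite h1 h2 h3.
Qed.

Lemma sub_sep C z A a b : C \subset chain_of z -> A \in C -> phi a \in A ->
  phi b \notin A -> (pos z a < pos z b)%N.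
Proof.
move=> /fintype.subsetP h /h/chain_ofP[s _ ->]; rewrite !mem_pref -leqNgt.
exact: leq_trans.
Qed.

(** Two letters that are inverted in the tight word are separated by a member of
    [C], hence inverted in every word of [C]. *)
Lemma admissible_star rho C y z : tight C y -> admissible rho y -> C \subset chain_of z ->
  key z = key y -> admissible rho z.
Proof.
move=> ty gy Cz ek; apply: admissible_ideal gy ek _ => a b ba eab zba.
rewrite ltnNge leq_eqVlt negb_or; apply/andP; split.
  by apply: contraTneq zba => /pos_inj ->; rewrite ltnn.
apply/negP => yab; have [A AC /andP[aA bA]] := tight_sep ty yab ba.
by have := sub_sep Cz AC aA bA; rewrite ltnNge ltnW.
Qed.

Lemma perm_order_ext y z :
  (forall a b, (pos y a < pos y b)%N -> (pos z a < pos z b)%N) -> y = z.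
Proof.
move=> h.
have h' a b : (pos y a < pos y b)%N = (pos z a < pos z b)%N.
  apply/idP/idP => [/h//|zab]; rewrite ltnNge leq_eqVlt negb_or; apply/andP; split.
    by apply: contraTneq zab => /pos_inj ->; rewrite ltnn.
  by apply/negP => /h; rewrite ltnNge ltnW.
have cnt u a : #|[set b | (pos u b < pos u a)%N]| = pos u a.
  by rewrite card_pos_lt // ltnW // pos_lt.
have e a : pos y a = pos z a.
  by rewrite -(cnt y) -(cnt z); apply: eq_card => b; rewrite !inE h'.
by apply: invg_inj; apply/permP => a; apply: ord_inj; apply: e.
Qed.

Lemma tight_uniq C y z : tight C y -> tight C z -> y = z.
Proof.
move=> ty tz; apply: perm_order_ext => a b yab.
rewrite ltnNge leq_eqVlt negb_or; apply/andP; split.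
  by apply: contraTneq yab => /pos_inj ->; rewrite ltnn.
apply/negP => zba.
have [ab|ba|/val_inj e] := ltngtP (a : nat) (b : nat).
- have [A AC /andP[bA aA]] := tight_sep tz zba ab.
  by have := sub_sep ty.1 AC bA aA; rewrite ltnNge ltnW.
- have [A AC /andP[aA bA]] := tight_sep ty yab ba.
  by have := sub_sep tz.1 AC aA bA; rewrite ltnNge ltnW.
- by move: yab; rewrite e ltnn.
Qed.

Definition swap y p q : {perm 'I_d} := (tperm p q * y)%g.

Lemma pos_swap y p q a : pos (swap y p q) a = tperm p q ((y^-1)%g a).
Proof. by rewrite /pos /swap invMg tpermV permM. Qed.

Lemma pref_swap y p q (s : 'I_d) : q = p.+1 :> nat -> s != q -> pref (swap y p q) s = pref y s.
Proof.
move=> e sq; have {}sq : s <> q :> nat by move=> /val_inj; apply/eqP.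
have H a : (pos (swap y p q) a < s)%N = (pos y a < s)%N.
  by rewrite pos_swap /pos; case: tpermP => [->|->|//]; lia.
by apply/setP => v; apply/imsetP/imsetP => -[a];
  rewrite inE => lt ->; exists a => //; rewrite inE ?H // -H.
Qed.

Lemma key_swap y p q : q = p.+1 :> nat -> (q : nat) \in S -> key (swap y p q) = key y.
Proof.
move=> e qS; apply/ffunP => a; rewrite !keyE pos_swap /pos.
have eq : run S q = run S p by rewrite e run_in // -e.
by case: tpermP => // ->; rewrite eq.
Qed.

Lemma sub_swap C y p q : q = p.+1 :> nat -> C \subset chain_of y ->
  pref y q \notin C -> C \subset chain_of (swap y p q).
Proof.
move=> e /fintype.subsetP Cy qC; apply/fintype.subsetP => A AC.
have /chain_ofP[s sS eA] := Cy _ AC.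
rewrite eA -(pref_swap y e (s:=s)) ?mem_chain_of //.
by apply: contraNneq qC => <-; rewrite -eA.
Qed.

Definition weight (wt : nat -> nat) y : nat := \sum_(r < d) wt r * y r.

(** One step of the rearrangement inequality. *)
Lemma weight_swap (wt : nat -> nat) y p q : q = p.+1 :> nat -> (y q < y p)%N ->
  (wt p <= wt q)%N ->
  (weight wt y <= weight wt (swap y p q) ?= iff (wt p == wt q))%N.
Proof.
move=> e lt le; have pq : p != q by apply: contra_eq_neq e => ->; rewrite neq_ltn ltnSn.
rewrite /weight (bigD1 p) //= (bigD1 q) 1?eq_sym //= [X in (_ <= X ?= iff _)%N](bigD1 p) //=.
rewrite [X in (_ <= _ + X ?= iff _)%N](bigD1 q) 1?eq_sym //=.
rewrite /swap !permM tpermL tpermR !addnA.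
under [X in (_ <= _ + X ?= iff _)%N]eq_bigr => r /andP[h1 h2] do
  rewrite permM tpermD 1?eq_sym //.
apply/leqifP; case: eqVneq => [->|ne]; first by rewrite [X in (X + _ == _)%N]addnC.
have {ne le} : (wt p < wt q)%N by rewrite ltn_neqAle ne.
rewrite ltn_add2r; nia.
Qed.

(** Depends on the class only, and orders the ears of a facet. *)
Definition potential (kap : {ffun 'I_d -> nat}) : nat := \sum_a kap a * a.

Lemma potential_key y : potential (key y) = weight (run S) y.
Proof.
rewrite /potential (reindex_inj (@perm_inj _ y)); apply: eq_bigr => p _.
by rewrite key_perm.
Qed.

Lemma weight_bound (wt : nat -> nat) y : (weight wt y <= \sum_(r < d) wt r * d)%N.
Proof. by apply: leq_sum => r _; rewrite leq_mul2l ltnW ?orbT. Qed.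

(** Bubble sort between consecutive members of [C]: each exchange increases the
    weight for the identity, which makes the process stop, and can only increase
    the potential; when the potential is unchanged, the exchange takes place
    inside a run. *)
Lemma potential_tight C y z : tight C y -> C \subset chain_of z ->
  (potential (key z) <= potential (key y))%N /\ (potential (key z) = potential (key y) -> key z = key y).
Proof.
move=> ty; set M := (\sum_(r < d) id r * d)%N.
have [n] := ubnP (M - weight id z)%N; elim: n z => // n IH z le Cz.
have [/existsP[p /existsP[q /and3P[/eqP e qC lt]]]|] :=
  boolP [exists p : 'I_d, exists q : 'I_d, [&& (q : nat) == p.+1, pref z q \notin C & (z q < z p)%N]].
  have le1 : (weight id z <= weight id (swap z p q) ?= iff ((p : nat) == q))%N.
    by apply: weight_swap; rewrite // e.
  have le2 : (weight (run S) z <= weight (run S) (swap z p q) ?= iff (run S p == run S q))%N.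
    by apply: weight_swap; rewrite // e leq_run.
  have pq : (p : nat) == q = false by rewrite e; apply/negbTE; rewrite neq_ltn ltnSn.
  have [] := IH (swap z p q).
  - move: le le1.1 le1.2; rewrite pq; have := weight_bound id (swap z p q); rewrite -/M.
    by move=> + + + /eqP; lia.
  - exact: sub_swap.
  rewrite !potential_key => h1 h2; split; first exact: leq_trans le2.1 _.
  move=> e2; have e3 : weight (run S) z = weight (run S) (swap z p q).
    by apply/eqP; rewrite eqn_leq le2.1 e2.
  have : run S p == run S q by rewrite -le2.2 e3.
  move=> /eqP eo; rewrite -h2 -?e3 // key_swap //.
  by apply: run_between eo; rewrite // e.
move=> nex; suff -> : z = y by [].
apply: tight_uniq ty; split=> // p q e qC.
rewrite ltnNge leq_eqVlt negb_or; apply/andP; split.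
  by apply/eqP => /val_inj/perm_inj eqp; move: e; rewrite eqp; lia.
apply: contra nex => lt; apply/existsP; exists p; apply/existsP; exists q.
by rewrite qC lt e eqxx.
Qed.

(** Take an admissible word of [C] in the class that is as close to increasing as
    possible.  It is not tight, so two adjacent letters can still be exchanged
    around [C], and by maximality the result is not admissible. *)
Lemma gallery rho C y0 : C \subset chain_of y0 -> admissible rho y0 ->
  (forall y, tight C y -> admissible rho y -> key y = key y0 -> False) ->
  exists y p q, [/\ q = p.+1 :> nat, (q : nat) \in S, pref y q \notin C,
    C \subset chain_of y & [/\ admissible rho y, key y = key y0 & ~~ admissible rho (swap y p q)]].
Proof.
move=> C0 g0 nt.
pose P y := [&& C \subset chain_of y, admissible rho y & key y == key y0].
have P0 : P y0 by rewrite /P C0 g0 /=.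
case: (arg_maxnP (weight id) P0) => y /and3P[Cy gy /eqP ky] ymax.
have [/existsP[p /existsP[q /and3P[/eqP e qC lt]]]|nex] :=
  boolP [exists p : 'I_d, exists q : 'I_d, [&& (q : nat) == p.+1, pref y q \notin C & (y q < y p)%N]]; last first.
  exfalso; apply: (nt y) => //; split=> // p q e qC.
  rewrite ltnNge leq_eqVlt negb_or; apply/andP; split.
    by apply/eqP => /val_inj/perm_inj eqp; move: e; rewrite eqp; lia.
  apply: contra nex => lt; apply/existsP; exists p; apply/existsP; exists q.
  by rewrite qC lt e eqxx.
have qS : (q : nat) \in S.
  apply: contraT => qS; have /admissibleP[g _] := gy.
  by have := g _ _ e qS; rewrite ltnNge ltnW.
exists y, p, q; split=> //; split=> //; apply/negP => gs.
have /ymax : P (swap y p q).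
  by rewrite /P gs sub_swap //= key_swap // ky.
have : (weight id y <= weight id (swap y p q) ?= iff ((p : nat) == q))%N.
  by apply: weight_swap; rewrite // e.
rewrite /= => -[h1 h2] h3; have h4 := eqn_leq (weight id y) (weight id (swap y p q)).
by move: h2; rewrite h4 h1 h3 e /=; lia.
Qed.

(** In the complex of a class, a ridge lies in exactly two facets. *)
Lemma ridge_facets y z p q : q = p.+1 :> nat -> (q : nat) \in S -> key z = key y ->
  (chain_of y :\ pref y q) \subset chain_of z -> z = y \/ z = swap y p q.
Proof.
move=> e qS ek /fintype.subsetP sub.
have h (s : 'I_d) : s != q -> pref z s = pref y s.
  move=> sq; have [sS|sS] := boolP ((s : nat) \in S); last exact: pref_key.
  have : pref y s \in chain_of y :\ pref y q.
    by rewrite !inE mem_chain_of // andbT; apply: contra sq => /eqP/pref_inj ->.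
  by move=> /sub/chain_ofP[t tS et]; rewrite et (pref_inj2 et).
have pe a s : s != q -> (pos z a < s)%N = (pos y a < s)%N.
  by move=> sq; rewrite -!mem_pref h.
have pz : pos z (y p) = p \/ pos z (y p) = q.
  have h1 (s : 'I_d) : s != q -> (pos z (y p) < s)%N = (p < s)%N.
    by move=> /pe ->; rewrite pos_perm.
  have [r _ er] := posP z (y p); rewrite er in h1 *.
  have pq : p != q by apply: contra_eq_neq e => ->; rewrite neq_ltn ltnSn.
  have := h1 p pq; rewrite ltnn => h2.
  have [->|rq] := eqVneq r q; first by right.
  left; apply/eqP; rewrite eqn_leq; apply/andP; split; last by rewrite leqNgt h2.
  by rewrite leqNgt -(h1 r rq) ltnn.
have fin u : (forall s : 'I_d, s != q -> pref u s = pref y s) ->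
   pos z (y p) = pos u (y p) -> (pos u (y p) = p \/ pos u (y p) = q) -> z = u.
  move=> hu ep pu; apply: eq_prefs => s; have [->|sq] := eqVneq s q; last by rewrite h ?hu.
  have pq : p != q by apply: contra_eq_neq e => ->; rewrite neq_ltn ltnSn.
  have pe' a : (pos z a < p)%N = (pos u a < p)%N by rewrite -!mem_pref h ?hu.
  have qd a : (pos z a <= q)%N = (pos u a <= q)%N.
    have [q1|q1] := ltnP q.+1 d; last first.
      have h1 w : (pos w a <= q)%N by rewrite -ltnS; apply: leq_trans q1; apply: pos_lt.
    by rewrite !h1.
    have := mem_pref z (Ordinal q1) a; have := mem_pref u (Ordinal q1) a.
    rewrite h ?hu ?ltnS //=; last 2 first.
    - by rewrite -val_eqE /= neq_ltn ltnSn orbT.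
    - by rewrite -val_eqE /= neq_ltn ltnSn orbT.
    by move=> -> ->.
  suff H a : (pos z a < q)%N = (pos u a < q)%N.
    by apply/setP => v; apply/imsetP/imsetP => -[a]; rewrite inE => lt ->; exists a => //;
      rewrite inE ?H // -H.
  have [->|ne] := eqVneq a (y p); first by rewrite ep.
  have n1 : pos z a != pos z (y p) by apply: contra ne => /eqP/pos_inj ->.
  have n2 : pos u a != pos u (y p) by apply: contra ne => /eqP/pos_inj ->.
  have := pe' a; have := qd a; move: n1 n2; rewrite ep; case: pu => ->; rewrite e; lia.
case: pz => pz; [left|right]; apply: fin => //; rewrite ?pos_perm ?pz; auto.
- by move=> s sq; apply: pref_swap.
- by rewrite pos_swap permK tpermL.
- by rewrite pos_swap permK tpermL; right.
Qed.

End Words.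

(** * Increasing rearrangements *)

Section Sorting.
Variable d : nat.

Lemma sorting_perm (le : rel 'I_d) : total le -> transitive le ->
  exists y : {perm 'I_d}, forall p q : 'I_d, (p < q)%N -> le (y p) (y q).
Proof.
move=> tot tr; set s := sort le (enum 'I_d).
have sz : size s = d by rewrite size_sort size_enum_ord.
have us : uniq s by rewrite sort_uniq enum_uniq.
pose f (p : 'I_d) : 'I_d := nth p s p.
have fi : injective f.
  move=> p q; rewrite /f (set_nth_default q) ?sz // => /eqP.
  by rewrite nth_uniq ?sz // => /eqP /val_inj.
exists (perm fi) => p q pq; rewrite !permE /f (set_nth_default q p) ?sz //.
by apply: (sorted_ltn_nth tr) => //; rewrite ?inE ?sz ?sort_sorted.
Qed.

End Sorting.

Section Tight.
Variables (V : finType) (d : nat) (S : pred nat) (phi : 'I_d -> V).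
Hypothesis phi_inj : injective phi.
Hypothesis S_lt : forall s, s \in S -> (s < d)%N.
Implicit Types (y z : {perm 'I_d}) (a b p q r : 'I_d) (C : {set {set V}}).

(** A set of letters that come before all the others is a prefix. *)
Lemma initial_pref y (A : {set V}) : A \subset [set phi a | a : 'I_d] ->
  (forall a b, phi a \in A -> phi b \notin A -> (pos y a < pos y b)%N) ->
  A = pref phi y #|A|.
Proof.
move=> sub h; pose P := [set a | phi a \in A].
have AP : A = [set phi a | a in P].
  apply/setP => v; apply/idP/imsetP => [vA|[a]]; last by rewrite inE => + ->.
  by have /imsetP[a _ e] := fintype.subsetP sub _ vA; exists a; rewrite // inE -e.
have cP : #|A| = #|P| by rewrite {1}AP card_imset.
suff H a : (phi a \in A) = (pos y a < #|A|)%N.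
  by rewrite {1}AP; apply: eq_imset_inP || (apply/setP => v; apply/imsetP/imsetP => -[a];
     rewrite inE ?H => h' ->; exists a => //; rewrite inE ?H).
have [aA|aA] := boolP (phi a \in A); apply/esym.
  rewrite cP -[X in (X <= _)%N](card_pos_lt y (pos_lt y a)) subset_leq_card //.
  apply/fintype.subsetP => b; rewrite !inE ltnS => lt; apply: contraLR lt => bA.
  by rewrite -ltnNge h.
apply/negbTE; rewrite -leqNgt cP -[X in (_ <= X)%N](card_pos_lt y (ltnW (pos_lt y a))).
by rewrite subset_leq_card //; apply/fintype.subsetP => b; rewrite !inE => bA; apply: h.
Qed.

(** Sort the letters by the number of members of [C] that avoid them, and by
    their value in case of a tie. *)
Lemma exists_tight C :
  (forall A, A \in C -> A \subset [set phi a | a : 'I_d]) ->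
  (forall A, A \in C -> #|A| \in S) ->
  (forall A B, A \in C -> B \in C -> (A \subset B) || (B \subset A)) ->
  exists y, tight S phi C y.
Proof.
move=> Csub CS Cch.
pose lev a := #|[set A in C | phi a \notin A]|.
(* the lexicographic order on pairs (level, letter), coded by a number *)
pose f a := (lev a * d + a)%N.
have f_lev a b : (lev a < lev b)%N -> (f a < f b)%N.
  by move=> lt; rewrite /f; have := ltn_ord a; nia.
have f_inj a b : f a = f b -> a = b.
  move=> e; have [/f_lev|/f_lev|e'] := ltngtP (lev a) (lev b); rewrite ?e ?ltnn //.
  by apply: val_inj; move: e; rewrite /f e' => /addnI.
have [y hy] : exists y : {perm 'I_d}, forall p q, (p < q)%N -> (f (y p) <= f (y q))%N.
  by apply: (@sorting_perm _ (fun a b => f a <= f b)%N) => [a b|b a c];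
    [exact: leq_total|exact: leq_trans].
have fpos a b : (f a < f b)%N -> (pos y a < pos y b)%N.
  have [p -> ->] := posP y a; have [q -> ->] := posP y b => lt.
  rewrite ltnNge leq_eqVlt negb_or; apply/andP; split.
    by apply: contraTneq lt => /val_inj ->; rewrite ltnn.
  by apply: contraTN lt => /hy le; rewrite -leqNgt.
have fy p q : (p < q)%N -> (f (y p) < f (y q))%N.
  move=> pq; rewrite ltn_neqAle hy // andbT; apply: contraTneq pq => /f_inj/perm_inj ->.
  by rewrite ltnn.
have C_pref A : A \in C -> A = pref phi y #|A|.
  move=> AC; apply: initial_pref; first exact: Csub.
  move=> a b aA bA; apply/fpos/f_lev/proper_card/properP; split.
    apply/fintype.subsetP => B; rewrite !inE => /andP[BC aB]; rewrite BC /=.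
    have /orP[/fintype.subsetP sub|/fintype.subsetP sub] := Cch _ _ AC BC.
      by rewrite (sub _ aA) in aB.
    by apply: contra bA; apply: sub.
  by exists A; rewrite !inE AC ?bA ?aA.
exists y; split.
  apply/fintype.subsetP => A AC; have AS := CS _ AC.
  by apply/chain_ofP; exists (Ordinal (S_lt AS)); rewrite //= -C_pref.
move=> p q e qC; have := fy p q; rewrite e ltnSn => /(_ isT).
suff el : lev (y p) = lev (y q) by rewrite /f el ltn_add2l.
apply: eq_card => A; rewrite !inE; case: (boolP (A \in C)) => //= AC.
rewrite (C_pref _ AC) !mem_pref // !pos_perm e; congr (~~ _); apply/idP/idP; last by lia.
move=> lt; rewrite ltnNge; apply: contra qC => le.
by rewrite (_ : (q : nat) = #|A|) -?C_pref // e; apply/eqP; rewrite eqn_leq lt.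
Qed.
End Tight.

(** * The fan of a descent class *)

(** The class of [y0] is realized in the space of functions on the letters modulo
    the functions that are constant on the letters of each run.  The coordinates
    [ps j] run over [S], that is, over the positions that do not start a run: a
    vector is the representative that vanishes at the letter by which [y0]
    starts each run. *)
Section Fan.
Local Open Scope ring_scope.
Variables (R : realType) (V : finType) (d : nat) (S : pred nat) (phi : 'I_d -> V).
Hypothesis phi_inj : injective phi.
Hypothesis S0 : 0%N \notin S.
Variable y0 : {perm 'I_d}.
Variables (n : nat) (ps : 'I_n -> 'I_d).
Hypothesis ps_inj : injective ps.
Hypothesis ps_S : forall j, (ps j : nat) \in S.
Hypothesis ps_surj : forall q : 'I_d, (q : nat) \in S -> exists j, ps j = q.
Implicit Types (y : {perm 'I_d}) (a b p q : 'I_d) (A : {set V}) (z : 'I_n -> R)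
  (x : {set V} -> R) (zz : 'I_d -> R).
Local Notation kap := (key S y0).
Local Notation ch := (chain_of S phi).
Local Notation pr := (pref phi).

(** The function on the letters with coordinates [z]. *)
Definition ext z a : R := \sum_(j | ps j == (y0^-1)%g a) z j.

Lemma ext_ps z j : ext z (y0 (ps j)) = z j.
Proof.
rewrite /ext permK (bigD1 j) //= big1 ?addr0 // => i /andP[/eqP/ps_inj -> ].
by rewrite eqxx.
Qed.

Lemma extD z z' a : ext (fun i => z i + z' i) a = ext z a + ext z' a.
Proof. by rewrite /ext -big_split. Qed.

Lemma extZ r z a : ext (fun i => r * z i) a = r * ext z a.
Proof. by rewrite /ext mulr_sumr. Qed.

Lemma ext_out z a : pos y0 a \notin S -> ext z a = 0.
Proof.
move=> h; rewrite /ext big1 // => j /eqP e; move: h; rewrite /pos -e.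
by rewrite ps_S.
Qed.

Lemma run_start_lt p : (run_start S p < d)%N.
Proof. exact: leq_ltn_trans (run_start_le S p) (ltn_ord p). Qed.

Definition run_head a : 'I_d := y0 (Ordinal (run_start_lt ((y0^-1)%g a))).

Lemma pos_run_head a : pos y0 (run_head a) = run_start S (pos y0 a).
Proof. by rewrite pos_perm. Qed.

Lemma key_run_head a : kap (run_head a) = kap a.
Proof. by rewrite !keyE pos_run_head run_run_start. Qed.

Lemma run_head_eq a b : kap a = kap b -> run_head a = run_head b.
Proof.
rewrite !keyE => e; apply: (@pos_inj _ y0); rewrite !pos_run_head; exact: run_start_eq.
Qed.

Lemma run_head_id a : pos y0 a \notin S -> run_head a = a.
Proof. by move=> h; apply: (@pos_inj _ y0); rewrite pos_run_head run_start_id. Qed.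

Lemma ext_run_head z a : ext z (run_head a) = 0.
Proof. by apply: ext_out; rewrite pos_run_head run_start_notin. Qed.

Definition indic A a : R := (phi a \in A)%:R.
Definition vertex_pt A (j : 'I_n) : R := indic A (y0 (ps j)) - indic A (run_head (y0 (ps j))).
Definition pcomb x (j : 'I_n) : R := \sum_A x A * vertex_pt A j.

Lemma ext_pcomb x a : ext (pcomb x) a = \sum_A x A * (indic A a - indic A (run_head a)).
Proof.
have [aS|aS] := boolP (pos y0 a \in S); last first.
  by rewrite ext_out // run_head_id // big1 // => A _; rewrite subrr mulr0.
have [j e] := ps_surj aS; have -> : a = y0 (ps j) by rewrite e permKV.
by rewrite ext_ps.
Qed.

Lemma ext_pcombB x a b : kap a = kap b ->
  ext (pcomb x) a - ext (pcomb x) b = \sum_A x A * (indic A a - indic A b).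
Proof.
move=> e; rewrite !ext_pcomb -sumrB; apply: eq_bigr => A _.
by rewrite (run_head_eq e) -mulrBr; congr (_ * _); lra.
Qed.

Lemma key_run y p q : key S y = kap -> run S p = run S q -> kap (y p) = kap (y q).
Proof. by move=> <- e; rewrite !key_perm. Qed.

Lemma indic_pref y s p : indic (pr y s) (y p) = (p < s)%N%:R.
Proof. by rewrite /indic mem_pref // pos_perm. Qed.

Definition supp x y : Prop := forall A, A \notin ch y -> x A = 0.

(** Among the prefixes of [y], only the one of length [q] separates the letters at
    positions p and p+1 = [q]. *)
Lemma chain_diff x y p q : key S y = kap -> supp x y -> q = p.+1 :> nat ->
  (q : nat) \in S -> ext (pcomb x) (y p) - ext (pcomb x) (y q) = x (pr y q).
Proof.
move=> ky sx e qS.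
rewrite ext_pcombB; last by apply: key_run; rewrite // e run_in // -e.
rewrite (bigD1 (pr y q)) //= !indic_pref // ltnn e ltnSn subr0 mulr1 big1 ?addr0 // => A An.
have [/chain_ofP[s sS eA]|/sx ->] := boolP (A \in ch y); last by rewrite mul0r.
rewrite eA !indic_pref e; have : (s : nat) != q by apply: contra An => /eqP es; rewrite eA es e.
move=> sq; suff -> : (p < s)%N = (p.+1 < s)%N by rewrite subrr mulr0.
by move/eqP: sq; rewrite e; lia.
Qed.

(** The cone of the word [y] consists of the functions that decrease along each
    run of [y]. *)
Definition sorts y zz : Prop :=
  forall p q, (p <= q)%N -> run S p = run S q -> zz (y q) <= zz (y p).

Lemma sorts_adj y zz :
  (forall p q, q = p.+1 :> nat -> (q : nat) \in S -> zz (y q) <= zz (y p)) -> sorts y zz.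
Proof.
apply: (@run_ind d S (fun p q => zz (y q) <= zz (y p))) => // p q s h1 h2.
exact: le_trans h2 h1.
Qed.

Lemma pcomb_sorts x y : key S y = kap -> supp x y -> (forall A, 0 <= x A) ->
  sorts y (ext (pcomb x)).
Proof.
by move=> ky sx x0; apply: sorts_adj => p q e qS; rewrite -subr_ge0 (chain_diff ky sx e).
Qed.

Definition Vtx A : bool := [exists y, (key S y == kap) && (A \in ch y)].
Definition sep A (ab : 'I_d * 'I_d) : bool :=
  [&& phi ab.1 \in A, phi ab.2 \notin A & kap ab.1 == kap ab.2].

(** The barycentric coordinate of a vertex [A] of the class: in the cone of a word
    that has [A] as a prefix, the drop from the last letter of [A] to the next
    letter, which is the least drop from a letter of [A] to a letter outside [A]
    in the same run; in the other cones this least drop is not positive.  The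
    initial value of the minimum is at least every drop. *)
Definition gap A zz : R :=
  if Vtx A then Num.max 0 (\big[Num.min/ \sum_ab `|zz ab.1 - zz ab.2|]_(ab | sep A ab)
                             (zz ab.1 - zz ab.2)) else 0.
Definition bary A z : R := gap A (ext z).

Lemma gap_ge0 A zz : 0 <= gap A zz.
Proof. by rewrite /gap; case: ifP => // _; rewrite le_max lexx. Qed.

Lemma Vtx_chain A y : Vtx A -> key S y = kap ->
  (forall a b, sep A (a, b) -> (pos y a < pos y b)%N) -> A \in ch y.
Proof.
move=> /existsP[y' /andP[/eqP ky' /chain_ofP[s sS eA]]] ky h.
have eA' : A = pr y #|A|.
  apply: initial_pref => //; first by rewrite eA pref_sub.
  move=> a b aA bA; have [e|ne] := eqVneq (kap a) (kap b).
    by apply: h; rewrite /sep aA bA e /=.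
  rewrite ltnNge; apply: contra ne => /(leq_run S); rewrite -!keyE ky => le.
  rewrite eqn_leq le andbT -ky' !keyE leq_run //.
  move: aA bA; rewrite eA !mem_pref // -leqNgt => h1 h2; exact: ltnW (leq_trans h1 h2).
by rewrite eA' eA card_pref ?(ltnW (ltn_ord s)) // mem_chain_of.
Qed.

Lemma gap_in y zz p q : key S y = kap -> sorts y zz -> q = p.+1 :> nat ->
  (q : nat) \in S -> gap (pr y q) zz = zz (y p) - zz (y q).
Proof.
move=> ky so e qS; have vq : Vtx (pr y q).
  by apply/existsP; exists y; rewrite ky eqxx mem_chain_of.
have eo : run S p = run S q by rewrite e run_in // -e.
have d0 : 0 <= zz (y p) - zz (y q) by rewrite subr_ge0 so // e.
rewrite /gap vq; set B := \big[_/_]_(_ | _) _.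
suff -> : B = zz (y p) - zz (y q) by apply/max_idPr.
apply/eqP; rewrite eq_le; apply/andP; split.
  apply: (@bigmin_le_cond _ _ _ _ (y p, y q)).
  by rewrite /sep /= !mem_pref // !pos_perm e ltnSn ltnn /= (key_run ky eo).
apply/bigmin_geP; split.
  rewrite (bigD1 (y p, y q)) //= (le_trans (ler_norm _)) // lerDl.
  by apply: sumr_ge0.
move=> [a b] /and3P[/=]; rewrite !mem_pref // -leqNgt.
have [r -> ->] := posP y a; have [s -> ->] := posP y b => h1 h2.
rewrite -ky !key_perm => /eqP eo'.
have rp : (r <= p)%N by rewrite -ltnS -e.
have h3 := leq_run S rp; have h4 := leq_run S h2.
have h5 : run S r = run S p by apply/eqP; rewrite eqn_leq h3 eo eo' h4.
have h6 : run S q = run S s by rewrite -eo -h5.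
apply: lerB; exact: so.
Qed.

Lemma gap_out y zz A : key S y = kap -> sorts y zz -> A \notin ch y -> gap A zz = 0.
Proof.
move=> ky so Ay; rewrite /gap; case: ifPn => // vA.
have [/existsP[[a b] /andP[sab le]]|nex] :=
    boolP [exists ab, sep A ab && (pos y ab.2 <= pos y ab.1)%N]; last first.
  case/negP: Ay; apply: Vtx_chain => // a b sab; rewrite ltnNge.
  by apply: contra nex => le; apply/existsP; exists (a, b); rewrite sab.
apply/max_idPl/(le_trans (bigmin_le_cond _ _ sab)) => /=.
have /and3P[_ _ /eqP] := sab; rewrite /= -ky.
move: le; rewrite /=; have [r -> ->] := posP y a; have [s -> ->] := posP y b => le.
by rewrite !key_perm => eo; rewrite subr_le0 so.
Qed.

Lemma bary_pcomb x y : key S y = kap -> supp x y -> (forall A, 0 <= x A) ->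
  forall A, bary A (pcomb x) = x A.
Proof.
move=> ky sx x0 A; have so := pcomb_sorts ky sx x0.
have [/chain_ofP[q qS ->]|Ay] := boolP (A \in ch y); last by rewrite /bary (gap_out ky so) // sx.
have q0 : (0 < q)%N by rewrite lt0n; apply: contraNneq S0 => <-.
have qd : (q.-1 < d)%N by apply: leq_ltn_trans (leq_pred _) (ltn_ord q).
have e : q = (Ordinal qd).+1 :> nat by rewrite /= prednK.
by rewrite /bary (gap_in ky so e) // (chain_diff ky sx e).
Qed.

Lemma bary_supp y z : key S y = kap -> sorts y (ext z) -> supp (bary^~ z) y.
Proof. by move=> ky so A; apply: gap_out. Qed.

(** Both sides drop by the same amount between consecutive letters of a run. *)
Lemma pcomb_bary y z : key S y = kap -> sorts y (ext z) -> pcomb (bary^~ z) = z.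
Proof.
move=> ky so; apply/funext => j; set z2 := pcomb _.
have adj p q : q = p.+1 :> nat -> (q : nat) \in S ->
    ext z (y p) - ext z2 (y p) = ext z (y q) - ext z2 (y q).
  move=> e qS; have := chain_diff ky (bary_supp ky so) e qS.
  rewrite /bary (gap_in ky so e) // -/z2; lra.
have H a b : kap a = kap b -> ext z a - ext z2 a = ext z b - ext z2 b.
  have [p -> _] := posP y a; have [q -> _] := posP y b; rewrite -ky !key_perm.
  have W := @run_ind d S (fun p q => ext z (y p) - ext z2 (y p) = ext z (y q) - ext z2 (y q))
     (fun _ => erefl) (fun _ _ _ => @etrans _ _ _ _) adj.
  by case: (leqP p q) => [/W//|/ltnW/W h e]; rewrite h.
have := H _ _ (esym (key_run_head (y0 (ps j)))); rewrite !ext_run_head !ext_ps; lra.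
Qed.

(** Listing the keys of the letters in increasing order gives the same sequence
    whatever the word. *)
Lemma key_of_sorted y : (forall p q, (p < q)%N -> (kap (y p) <= kap (y q))%N) ->
  key S y = kap.
Proof.
move=> h; apply/ffunP => a; have [p -> _] := posP y a; rewrite key_perm.
pose s1 := [seq kap (y r) | r <- enum 'I_d]; pose s2 := [seq run S r | r : 'I_d <- enum 'I_d].
have sz : size (enum 'I_d) = d by rewrite size_enum_ord.
have nE (f : 'I_d -> nat) (i : nat) (lt : (i < d)%N) :
    nth 0%N [seq f r | r <- enum 'I_d] i = f (Ordinal lt).
  by rewrite (nth_map (Ordinal lt)) ?sz // -[X in nth _ _ X]/(val (Ordinal lt)) nth_ord_enum.
have so (f : 'I_d -> nat) : (forall p q : 'I_d, (p < q)%N -> (f p <= f q)%N) ->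
    sorted leq [seq f r | r <- enum 'I_d].
  move=> hf; apply/(sortedP 0%N) => i; rewrite size_map sz => lt.
  by rewrite (nE f _ (ltnW lt)) (nE f _ lt) hf.
have pm (u : {perm 'I_d}) : perm_eq [seq kap (u r) | r <- enum 'I_d] [seq kap r | r <- enum 'I_d].
  rewrite (_ : [seq kap (u r) | r <- enum 'I_d] = [seq kap r | r <- [seq u r | r <- enum 'I_d]]).
    apply: perm_map; apply: uniq_perm; rewrite ?enum_uniq //.
      by rewrite map_inj_uniq ?enum_uniq //; apply: perm_inj.
    move=> b; rewrite mem_enum; apply/mapP; exists ((u^-1)%g b); rewrite ?mem_enum //.
    by rewrite permKV.
  by rewrite -[RHS]map_comp.
have e : s1 = s2.
  apply: (sorted_eq leq_trans anti_leq); [exact: so| |].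
    by apply: so => r q rq; apply/leq_run/ltnW.
  rewrite /s2 (_ : [seq run S r | r : 'I_d <- enum 'I_d] = [seq kap (y0 r) | r <- enum 'I_d]).
    by apply: perm_trans (pm y) _; rewrite perm_sym; apply: pm.
  by apply: eq_map => r; rewrite key_perm.
have := congr1 (fun s => nth 0%N s p) e.
by rewrite /s1 /s2 !(nE _ _ (ltn_ord p)) (_ : Ordinal _ = p) //; apply: val_inj.
Qed.

(** Ties are broken in favour of the larger letter, so that the word inverts as
    many pairs as the values of [zz] permit. *)
Lemma sort_exists zz : exists y, [/\ key S y = kap, sorts y zz &
  forall a b, kap a = kap b -> (b < a)%N -> (pos y b < pos y a)%N -> zz a < zz b].
Proof.
(* first by run, then by decreasing value, then by decreasing letter *)
pose le a b := [|| (kap a < kap b)%N, (kap a == kap b) && (zz b < zz a) |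
   [&& kap a == kap b, zz a == zz b & (b <= a)%N]].
have [y hy] : exists y : {perm 'I_d}, forall p q, (p < q)%N -> le (y p) (y q).
  apply: sorting_perm.
    move=> a b; rewrite /le; case: (ltngtP (kap a) (kap b)) => //= _.
    by case: (ltgtP (zz a) (zz b)) => //= _; rewrite leq_total.
  move=> b a c; rewrite /le.
  move=> /or3P[h1|/andP[/eqP h1 h2]|/and3P[/eqP h1 /eqP h2 h3]]
         /or3P[g1|/andP[/eqP g1 g2]|/and3P[/eqP g1 /eqP g2 g3]].
  - by rewrite (ltn_trans h1 g1).
  - by rewrite -g1 h1.
  - by rewrite -g1 h1.
  - by rewrite h1 g1.
  - by rewrite h1 g1 eqxx (lt_trans g2 h2) orbT.
  - by rewrite h1 g1 eqxx -g2 h2 orbT.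
  - by rewrite h1 g1.
  - by rewrite h1 g1 eqxx h2 g2 orbT.
  - by rewrite h1 g1 h2 g2 !eqxx (leq_trans g3 h3) !orbT.
have ky : key S y = kap.
  apply: key_of_sorted => p q /hy /or3P[/ltnW//|/andP[/eqP -> //]|/and3P[/eqP -> //]].
exists y; split=> //.
  move=> p q; rewrite leq_eqVlt => /orP[/eqP/val_inj -> //|/hy le_ eo].
  have eo' := key_run ky eo.
  case/or3P: le_; first by rewrite eo' ltnn.
    by move=> /andP[_ /ltW].
  by move=> /and3P[_ /eqP ->].
move=> a b eab ba; have [p ep ->] := posP y b; have [q eq ->] := posP y a => pq.
have /or3P[|/andP[_]|] := hy _ _ pq; rewrite -?ep -?eq //.
  by rewrite eab ltnn.
by move=> /and3P[_ _ le_]; move: ba; rewrite ltnNge le_.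
Qed.

Lemma contf_ext a : contf (fun z => ext z a).
Proof. by rewrite /ext; apply: contf_sum => j T z t; apply. Qed.

Lemma contf_bary A : contf (bary A).
Proof.
rewrite /bary /gap; case: (Vtx A); last by move=> T z t _; exact: cst_continuous.
have cd (ab : 'I_d * 'I_d) : contf (fun z => ext z ab.1 - ext z ab.2).
  move=> T z t hz; exact: (cvgB (contf_ext (a := ab.1) hz) (contf_ext (a := ab.2) hz)).
apply: contf_max; first by move=> T z t _; exact: cst_continuous.
apply: (@big_closed R n (@contf R 'I_n) Num.min (@contf_min R 'I_n) _ _ (sep A)
   (fun z => \sum_ab `|ext z ab.1 - ext z ab.2|) (fun ab z => ext z ab.1 - ext z ab.2)) => //.
apply: contf_sum => ab T z t hz.
exact: (cvg_norm (cd ab T z t hz)).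
Qed.

End Fan.

(** * The sphere of a descent class is polytopal *)

Section SpherePolytope.
Local Open Scope ring_scope.
Variables (R : realType) (V : finType) (d : nat) (S : pred nat) (phi : 'I_d -> V).
Hypothesis phi_inj : injective phi.
Hypothesis S0 : 0%N \notin S.
Variables (y0 : {perm 'I_d}) (n : nat) (ps : 'I_n -> 'I_d).
Hypothesis ps_inj : injective ps.
Hypothesis ps_S : forall j, (ps j : nat) \in S.
Hypothesis ps_surj : forall q : 'I_d, (q : nat) \in S -> exists j, ps j = q.
Implicit Types (y : {perm 'I_d}) (a b p q : 'I_d) (ab : 'I_d * 'I_d) (A : {set V}).
Local Notation kap := (key S y0).
Local Notation ch := (chain_of S phi).
Local Notation ext := (@ext R d y0 _ ps).
Local Notation indic := (@indic R V d phi).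
Local Notation Vtx := (Vtx S phi y0).
Local Notation sep := (sep S phi y0).
Local Notation vertex_pt := (@vertex_pt R V d S phi y0 _ ps).

Definition sphere_cx : {set {set {set V}}} :=
  [set C : {set {set V}} | [exists y, (key S y == kap) && (C \subset ch y)]]%SET.

Definition nb_sep A : R := (#|[set ab | sep A ab]%SET|)%:R.

(** [nb_sep A] is the value at the indicator of [A] of the sum of the distances
    |x_a - x_b| over the pairs in a common run; dividing by it moves the vertex to
    the unit sphere of this function. *)
Definition sphere_pt A : 'rV[R]_n := (nb_sep A)^-1 *: \row_j vertex_pt A j.
Definition coord_col a : 'cV[R]_n := \col_j (ps j == (y0^-1)%g a)%:R.

(** The same sum on the cone of [y], where it is linear. *)
Definition facet_col y : 'cV[R]_n :=
  \sum_(pq : 'I_d * 'I_d | (pq.1 < pq.2)%N && (run S pq.1 == run S pq.2))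
    (coord_col (y pq.1) - coord_col (y pq.2)).

Lemma dot_coord_col (z : 'rV[R]_n) a : dot z (coord_col a) = ext (z 0) a.
Proof.
rewrite /dot mxE /coord_col [RHS]big_mkcond; apply: eq_bigr => j _; rewrite mxE.
by case: (ps j == _); rewrite ?mulr1 ?mulr0.
Qed.

Lemma ext_vertex_pt A a b : kap a = kap b -> ext (vertex_pt A) a - ext (vertex_pt A) b = indic A a - indic A b.
Proof.
move=> e; have W : vertex_pt A = pcomb S phi y0 ps (fun B => (B == A)%:R).
  apply/funext => j; rewrite /pcomb (bigD1 A) //= eqxx mul1r big1 ?addr0 // => B /negbTE ->.
  by rewrite mul0r.
rewrite W ext_pcombB // (bigD1 A) //= eqxx mul1r big1 ?addr0 // => B /negbTE ->.
by rewrite mul0r.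
Qed.

Lemma dot_sphere_pt A y a b : kap a = kap b ->
  dot (sphere_pt A) (coord_col a - coord_col b) = (nb_sep A)^-1 * (indic A a - indic A b).
Proof.
move=> e; rewrite dotZ dotBr !dot_coord_col; congr (_ * _).
have -> : (\row_j vertex_pt A j : 'rV[R]_n) 0 = vertex_pt A by apply/funext => j; rewrite mxE.
exact: ext_vertex_pt.
Qed.

(** The number of pairs that [A] separates in the order opposite to [y].  The
    functional of [y] counts them negatively, so it supports the sphere exactly at
    the vertices that have no such pair, the prefixes of [y]. *)
Definition nb_wrong A y : R :=
  (#|[set pq : 'I_d * 'I_d | [&& (pq.1 < pq.2)%N, run S pq.1 == run S pq.2,
      phi (y pq.1) \notin A & phi (y pq.2) \in A]]%SET|)%:R.

Lemma nb_sep_split A y : key S y = kap ->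
  \sum_(pq : 'I_d * 'I_d | (pq.1 < pq.2)%N && (run S pq.1 == run S pq.2))
     (indic A (y pq.1) - indic A (y pq.2)) = nb_sep A - nb_wrong A y *+ 2.
Proof.
move=> ky; pose s (pq : 'I_d * 'I_d) : R :=
  ((run S pq.1 == run S pq.2) && (phi (y pq.1) \in A) && (phi (y pq.2) \notin A))%:R.
pose sw (pq : 'I_d * 'I_d) := (pq.2, pq.1).
have swi : injective sw by move=> [? ?] [? ?] [-> ->].
have e1 : nb_sep A = \sum_pq s pq.
  rewrite /nb_sep -sum1dep_card natr_sum big_mkcond /=.
  pose yy (pq : 'I_d * 'I_d) := (y pq.1, y pq.2).
  have yyi : injective yy by move=> [? ?] [? ?] [/perm_inj -> /perm_inj ->].
  rewrite (reindex_inj yyi) /=; apply: eq_bigr => -[p q] _.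
  rewrite /sep /s /= -ky !key_perm; case: (run S p == run S q); rewrite ?andbF //=.
  by rewrite andbT; case: (_ && _).
have e2 : nb_wrong A y = \sum_(pq : 'I_d * 'I_d | (pq.1 < pq.2)%N) s (sw pq).
  rewrite /nb_wrong -sum1dep_card natr_sum big_mkcond [RHS]big_mkcond /=.
  apply: eq_bigr => -[p q] _; rewrite /s /= eq_sym.
  case: (p < q)%N; case: (run S q == run S p) => //=.
  by rewrite andbC; case: (_ && _).
have e3 : \sum_pq s pq = \sum_(pq : 'I_d * 'I_d | (pq.1 < pq.2)%N) s pq + nb_wrong A y.
  rewrite e2 (bigID (fun pq : 'I_d * 'I_d => (pq.1 < pq.2)%N)) /=; congr (_ + _).
  rewrite (reindex_inj swi) /= big_mkcond [RHS]big_mkcond; apply: eq_bigr => -[p q] _ /=.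
  rewrite -leqNgt leq_eqVlt; have [/val_inj -> |_] /= := eqVneq (p : nat) q.
    by rewrite ltnn /s /= eqxx andbN.
  by [].
rewrite e1 e3 mulr2n opprD addrA addrK e2 -sumrB big_mkcondr /=; apply: eq_bigr => -[p q] _.
rewrite /s /sw /indic /= [run S q == _]eq_sym; case: (run S p == run S q) => /=; last by rewrite subrr.
by case: (_ \in A); case: (_ \in A); rewrite ?subrr ?subr0 ?sub0r.
Qed.

Lemma nb_sep_gt0 A : Vtx A -> 0 < nb_sep A.
Proof.
move=> /existsP[y /andP[/eqP ky /chain_ofP[q qS eA]]].
have q0 : (0 < q)%N by rewrite lt0n; apply: contraNneq S0 => <-.
have qd : (q.-1 < d)%N by apply: leq_ltn_trans (leq_pred _) (ltn_ord q).
rewrite ltr0n card_gt0; apply/set0Pn; exists (y (Ordinal qd), y q).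
rewrite inE /sep eA /= !mem_pref // !pos_perm /= ltnn prednK // leqnn /=.
by rewrite -ky !key_perm /= -[in run S q](prednK q0) run_in ?prednK.
Qed.

Lemma dot_facet_col A y : key S y = kap ->
  dot (sphere_pt A) (facet_col y) = (nb_sep A)^-1 * (nb_sep A - nb_wrong A y *+ 2).
Proof.
move=> ky; rewrite /facet_col dot_sumr -nb_sep_split // mulr_sumr; apply: eq_bigr => -[p q] /andP[_ /eqP e].
by rewrite dot_sphere_pt //; apply: key_run.
Qed.

Lemma nb_wrong_eq0 A y : Vtx A -> key S y = kap -> (nb_wrong A y == 0) = (A \in ch y).
Proof.
move=> vA ky; rewrite pnatr_eq0 cards_eq0; apply/eqP/idP => [e|/chain_ofP[s sS ->]].
  apply: (Vtx_chain phi_inj vA ky) => a b /and3P[/=].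
  have [p -> ->] := posP y a; have [q -> ->] := posP y b => aA bA.
  rewrite -ky !key_perm => eo; rewrite ltnNge; apply/negP => le.
  have /setP/(_ (q, p)) := e; rewrite !inE /= [run S q == _]eq_sym eo aA bA !andbT.
  rewrite ltn_neqAle le andbT => /negbFE/eqP/val_inj eqp.
  by move: bA; rewrite eqp aA.
apply/setP => -[p q]; rewrite !inE /= !mem_pref // !pos_perm -leqNgt.
by apply/negP => /and4P[h1 _ h2 h3]; have := leq_trans h3 (leq_trans h2 (ltnW h1)); rewrite ltnn.
Qed.

Theorem sphere_polytope : exists (P : set 'rV[R]_n),
  [/\ simplicial_polytope n P, {in [set A | Vtx A]%SET &, injective sphere_pt} &
      image_complex sphere_pt sphere_cx = boundary_complex P].
Proof.
pose Y := {y : {perm 'I_d} | key S y == kap}.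
have ky (y : Y) : key S (val y) = kap by apply/eqP/(valP y).
apply: (@fan_polytope R n {set V} Y sphere_pt (fun y : Y => ch (val y))
  (fun y : Y => facet_col (val y))).
- move=> A; rewrite inE; split=> [/existsP[y /andP[h1 h2]]|[y h]].
    by exists (exist _ y h1).
  by apply/existsP; exists (val y); rewrite h (valP y).
- move=> C; rewrite inE; split=> [/existsP[y /andP[h1 h2]]|[y h]].
    by exists (exist _ y h1).
  by apply/existsP; exists (val y); rewrite h (valP y).
- move=> y A; rewrite inE => vA; have p0 := nb_sep_gt0 vA.
  have n0 : 0 <= nb_wrong A (val y) by exact: ler0n.
  by rewrite dot_facet_col // mulrC ler_pdivrMr // mul1r; lra.
- move=> y A; rewrite inE => vA; have p0 := nb_sep_gt0 vA.
  rewrite dot_facet_col // -(nb_wrong_eq0 vA) //; split=> [e|/eqP ->].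
    have : nb_sep A - nb_wrong A (val y) *+ 2 = nb_sep A.
      by rewrite -[RHS]mulr1 -e mulrA divff ?mul1r // gt_eqF.
    by move=> e'; apply/eqP; lra.
  by rewrite mul0rn subr0 mulVf // gt_eqF.
- move=> z; have [y [ky' so _]] := sort_exists S y0 (ext (z 0)).
  exists (exist _ y (introT eqP ky')), (fun A => bary S phi y0 ps A (z 0) * nb_sep A); split=> /=.
  + by move=> A; rewrite mulr_ge0 ?gap_ge0 // /nb_sep ler0n.
  + by move=> A Ay; rewrite (bary_supp phi_inj ky' so Ay) mul0r.
  + apply/matrix.rowP => j.
    have := pcomb_bary phi_inj S0 ps_inj ps_S ps_surj ky' so => /(congr1 (fun f => f j)).
    rewrite {1}/pcomb => <-; rewrite summxE; apply: eq_bigr => A _.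
    rewrite !mxE mulrA -mulrA mulrA; have [vA|vA] := boolP (Vtx A).
      have p0 := nb_sep_gt0 vA; rewrite mulfK ?gt_eqF //.
    by rewrite /bary /gap (negbTE vA) !mul0r.
- move=> y A /chain_ofP[q qS eA].
  have q0 : (0 < q)%N by rewrite lt0n; apply: contraNneq S0 => <-.
  have qd : (q.-1 < d)%N by apply: leq_ltn_trans (leq_pred _) (ltn_ord q).
  have vA : Vtx A by apply/existsP; exists (val y); rewrite (valP y) eA mem_chain_of.
  have p0 := nb_sep_gt0 vA; pose p := Ordinal qd.
  have eq : q = p.+1 :> nat by rewrite /= prednK.
  exists (nb_sep A *: (coord_col (val y p) - coord_col (val y q))) => B /chain_ofP[s sS eB].
  rewrite dotZr dot_sphere_pt //; last first.
    by apply: key_run; rewrite // eq run_in // -eq.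
  rewrite eB eA !indic_pref //; have [->|ne] := eqVneq s q.
    by rewrite eqxx ltnn -eA eq ltnSn subr0 mulr1 divff // gt_eqF.
  rewrite (_ : (p < s)%N = (q < s)%N) ?subrr ?mulr0; last first.
    rewrite eq; have : (s : nat) <> q by move=> /val_inj; apply/eqP.
    by rewrite eq; lia.
  by case: eqP => // /(pref_inj phi_inj) e; rewrite e eqxx in ne.
Qed.
End SpherePolytope.

(** * Ears are balls *)

Section EarBall.
Local Open Scope ring_scope.
Variables (R : realType) (V : finType) (d : nat) (S : pred nat) (phi : 'I_d -> V).
Hypothesis phi_inj : injective phi.
Hypothesis S0 : 0%N \notin S.
Variables (rho : nat) (y0 z0 : {perm 'I_d}).
Hypothesis y0_adm : admissible S rho y0.
Hypothesis z0_key : key S z0 = key S y0.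
Hypothesis z0_bad : ~~ admissible S rho z0.
Variables (m : nat) (ps : 'I_m.+1 -> 'I_d).
Hypothesis ps_inj : injective ps.
Hypothesis ps_S : forall j, (ps j : nat) \in S.
Hypothesis ps_surj : forall q : 'I_d, (q : nat) \in S -> exists j, ps j = q.
Implicit Types (y : {perm 'I_d}) (a b p q : 'I_d) (ab : 'I_d * 'I_d) (A : {set V}) (z : 'I_m.+1 -> R)
  (x : {set V} -> R).
Local Notation kap := (key S y0).
Local Notation ch := (chain_of S phi).
Local Notation ext := (@ext R d y0 _ ps).
Local Notation run_head := (run_head S y0).

Definition in_ear y : bool := admissible S rho y && (key S y == kap).
Definition dec_pair y (ab : 'I_d * 'I_d) : bool :=
  [&& (ab.2 < ab.1)%N, kap ab.1 == kap ab.2 & (pos y ab.1 < pos y ab.2)%N].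

(** A word without decreasing pairs would make every word of its class admissible,
    by [admissible_ideal]. *)
Lemma dec_pair_exists y : in_ear y -> exists ab, dec_pair y ab.
Proof.
move=> /andP[gy /eqP ky]; apply/existsP; apply: contraT => /existsPn nex.
case/negP: z0_bad; apply: (admissible_ideal gy); first by rewrite ky.
move=> a b ba; rewrite ky => e _.
have := nex (a, b); rewrite /dec_pair /= ba e eqxx /= -leqNgt leq_eqVlt => /orP[/eqP/pos_inj e'|//].
by rewrite e' ltnn in ba.
Qed.

Definition slope (ab : 'I_d * 'I_d) z : R :=
  (ext z ab.1 - ext z ab.2) / ((ab.1 : nat)%:R - (ab.2 : nat)%:R).

(** The function that sends each letter to its value; it is interior to the cone
    of the decreasing words of the class. *)
Definition axis (j : 'I_m.+1) : R :=
  ((y0 (ps j) : nat)%:R - (run_head (y0 (ps j)) : nat)%:R).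

Lemma ext_axis a : ext axis a = (a : nat)%:R - (run_head a : nat)%:R.
Proof.
have [aS|aS] := boolP (pos y0 a \in S); last by rewrite (ext_out ps_S) // run_head_id // subrr.
have [j e] := ps_surj aS; have -> : a = y0 (ps j) by rewrite e permKV.
by rewrite ext_ps.
Qed.

Lemma level_slope ab : (ab.2 < ab.1)%N -> kap ab.1 = kap ab.2 -> level axis (slope ab).
Proof.
move=> lt e.
have n0 : (ab.1 : nat)%:R - (ab.2 : nat)%:R != 0 :> R by rewrite subr_eq0 eqr_nat gtn_eqF.
split.
- move=> T z t hz.
  exact: (cvgM (cvgB (contf_ext (a := ab.1) hz) (contf_ext (a := ab.2) hz)) (cvg_cst _)).
- by move=> r z r0; rewrite /slope !extZ -mulrBr mulrA.
- move=> t z; rewrite /slope !extD !extZ !ext_axis (run_head_eq e).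
  by field.
Qed.

(** Nonnegative on the cones of the words of the class that invert at least the
    pairs inverted by [y]; these cones form a convex region. *)
Definition word_height y z : R :=
  if [pick ab | dec_pair y ab] is Some ab0
  then \big[Num.min/slope ab0 z]_(ab | dec_pair y ab) slope ab z else 0.
Definition ear_height z : R := \big[Num.max/word_height y0 z]_(y | in_ear y) word_height y z.

Lemma level_word_height y : in_ear y -> level axis (word_height y).
Proof.
move=> /dec_pair_exists[ab1 h1]; rewrite /word_height; case: pickP => [ab0 h0|/(_ ab1)]; last by rewrite h1.
have ls ab : dec_pair y ab -> level axis (slope ab).
  by move=> /and3P[lt /eqP e _]; apply: level_slope.
exact: (@big_closed R _ (level axis) Num.min (@level_min R _ axis) _ _ (dec_pair y) (slope ab0) slope (ls _ h0) ls).
Qed.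

Lemma in_ear_self : in_ear y0. Proof. by rewrite /in_ear y0_adm eqxx. Qed.

Lemma level_ear_height : level axis ear_height.
Proof. exact: (@big_closed R _ (level axis) Num.max (@level_max R _ axis) _ _ in_ear (word_height y0) word_height (level_word_height in_ear_self) level_word_height). Qed.

Lemma slope_ge0 ab z : (ab.2 < ab.1)%N -> (0 <= slope ab z) = (ext z ab.2 <= ext z ab.1).
Proof.
by move=> lt; rewrite /slope pmulr_lge0 ?subr_ge0 // invr_gt0 subr_gt0 ltr_nat.
Qed.

Lemma word_height_ge0 y z : in_ear y ->
  0 <= word_height y z <-> forall ab, dec_pair y ab -> ext z ab.2 <= ext z ab.1.
Proof.
move=> /dec_pair_exists[ab1 h1]; rewrite /word_height; case: pickP => [ab0 h0|/(_ ab1)]; last by rewrite h1.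
split=> [/bigmin_geP[_ h] ab hab|h].
  by rewrite -slope_ge0 ?h //; case/and3P: hab.
have h' ab : dec_pair y ab -> 0 <= slope ab z.
  by move=> hab; rewrite slope_ge0 ?h //; case/and3P: hab.
by apply/bigmin_geP; split; [apply: h'|].
Qed.

Lemma ear_height_ge0 z : 0 <= ear_height z <->
  exists2 y, in_ear y & forall ab, dec_pair y ab -> ext z ab.2 <= ext z ab.1.
Proof.
split=> [h|[y Nyy /(word_height_ge0 z Nyy) h]]; last first.
  exact: le_trans h (le_bigmax_cond _ _ Nyy).
have [/existsP[y /andP[Nyy]]|/existsPn nex] := boolP [exists y, in_ear y && (0 <= word_height y z)].
  by move/(word_height_ge0 z Nyy) => h'; exists y.
move: h; rewrite leNgt => /negP[]; apply/bigmax_ltP; split.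
  by have := nex y0; rewrite in_ear_self /= -ltNge.
by move=> y Nyy; have := nex y; rewrite Nyy /= -ltNge.
Qed.

Definition ear_cx : {set {set {set V}}} :=
  [set C : {set {set V}} | [exists y, [&& admissible S rho y, key S y == kap & C \subset ch y]]]%SET.

Lemma ear_cxP (C : {set {set V}}) : reflect (exists2 y, in_ear y & C \subset ch y) (C \in ear_cx).
Proof.
rewrite inE; apply: (iffP existsP) => [[y /and3P[h1 h2 h3]]|[y /andP[h1 h2] h3]].
  by exists y; rewrite // /in_ear h1.
by exists y; apply/and3P.
Qed.

Let pt' A j := @vertex_pt R V d S phi y0 _ ps A j.
Let bary' A z := @bary R V d S phi y0 _ ps A z.

Lemma cone_chain x : in_cone ear_cx x ->
  exists y, [/\ in_ear y, supp S phi x y & forall A, 0 <= x A].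
Proof.
move=> [x0 [C /ear_cxP[y Nyy Cy] xC]]; exists y; split=> // A Ay.
by apply: contraNeq Ay => /xC/(fintype.subsetP Cy).
Qed.

(** A function of nonnegative height satisfies the inequalities of some admissible
    word; the word that sorts it inverts more pairs, hence is admissible. *)
Theorem ear_ball : simplicial_ball R ear_cx.
Proof.
have [hc hhom hsh] := level_ear_height.
have c0 : axis ord0 != 0.
  rewrite /axis subr_eq0 eqr_nat; apply/eqP => /val_inj e.
  have := congr1 (pos y0) e; rewrite pos_run_head pos_perm => e'.
  by have := run_start_notin (ps ord0) S0; rewrite -e' ps_S.
apply: (@half_space_ball R _ ear_cx m pt' bary' ear_height axis) => //.
- by move=> A; apply: contf_bary.
- move=> x /cone_chain[y [Nyy sx x0]]; have /andP[_ /eqP ky] := Nyy.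
  apply/ear_height_ge0; exists y => // -[a b] /and3P[/= ba /eqP e].
  have := pcomb_sorts phi_inj S0 ps_inj ps_S ps_surj ky sx x0.
  move: e ba; rewrite -ky; have [p -> ->] := posP y a; have [q -> ->] := posP y b.
  by rewrite !key_perm => e _ so pq; apply: so; rewrite // ltnW.
- move=> x A /cone_chain[y [/andP[_ /eqP ky] sx x0]].
  exact: (bary_pcomb phi_inj S0 ps_inj ps_S ps_surj ky sx x0).
- move=> z /ear_height_ge0[y Nyy hy]; split; first by move=> A; apply: gap_ge0.
  have [y' [ky' so inv]] := sort_exists S y0 (ext z).
  have N' : in_ear y'.
    have /andP[gy /eqP ky] := Nyy.
    rewrite /in_ear ky' eqxx andbT; apply: (admissible_ideal gy); first by rewrite ky.
    move=> a b ba; rewrite ky => e ba'.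
    rewrite ltnNge; apply/negP => le.
    have := inv a b e ba ba'; rewrite ltNge => /negP[]; apply: (hy (a, b)).
    rewrite /dec_pair /= ba e eqxx /= ltn_neqAle le andbT.
    by apply: contraTneq ba => /pos_inj ->; rewrite ltnn.
  exists (ch y'); first by apply/ear_cxP; exists y'.
  move=> A; apply: contraNT => Ay; apply/eqP.
  exact: (gap_out phi_inj ky' so Ay).
- move=> z /ear_height_ge0[y Nyy hy].
  have [y' [ky' so inv]] := sort_exists S y0 (ext z).
  exact: (pcomb_bary phi_inj S0 ps_inj ps_S ps_surj ky' so).
Qed.
End EarBall.

(** * Boundaries of ears *)

Section OneEar.
Variables (V : finType) (d : nat) (S : pred nat) (phi : 'I_d -> V).
Hypothesis phi_inj : injective phi.
Hypothesis S0 : 0%N \notin S.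
Variables (rho : nat) (y0 : {perm 'I_d}).
Hypothesis y0_adm : admissible S rho y0.
Implicit Types (y z : {perm 'I_d}) (C F H : {set {set V}}).
Local Notation ch := (chain_of S phi).
Local Notation ear := (ear_cx S phi rho y0).
Local Notation N := (in_ear S rho y0).
Local Notation k := #|[set s : 'I_d | (s : nat) \in S]%SET|.

Lemma ear_complex : is_complex ear.
Proof.
split; first by apply/ear_cxP; exists y0; rewrite ?finset.sub0set ?(in_ear_self y0_adm).
move=> F G /ear_cxP[y Nyy Fy] GF; apply/ear_cxP; exists y => //.
exact: fintype.subset_trans GF Fy.
Qed.

Lemma ear_crank : crank ear = k.
Proof.
apply/eqP; rewrite eqn_leq; apply/andP; split.
  apply/bigmax_leqP => F /ear_cxP[y _ Fy]; rewrite -(card_chain_of S phi_inj y).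
  exact: subset_leq_card.
rewrite -(card_chain_of S phi_inj y0) /crank; apply: leq_bigmax_cond.
by apply/ear_cxP; exists y0; rewrite ?(in_ear_self y0_adm).
Qed.

Lemma ear_facetP H : reflect (exists2 y, N y & H = ch y) (H \in facets ear).
Proof.
rewrite inE; apply: (iffP maxsetP) => [[/ear_cxP[y Nyy Hy] mx]|[y Nyy ->]].
  exists y => //; apply/esym/mx => //; by apply/ear_cxP; exists y.
split; first by apply/ear_cxP; exists y.
move=> G /ear_cxP[u Nu Gu] sub; apply/esym/eqP; rewrite eqEcard sub /=.
by rewrite card_chain_of // -(card_chain_of S phi_inj u) subset_leq_card.
Qed.

Lemma swap_neq y (p q : 'I_d) : p != q -> swap y p q != y.
Proof.
apply: contraNneq => /(congr1 (fun u : {perm 'I_d} => u p)).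
by rewrite /swap permM tpermL => /perm_inj ->.
Qed.

(** From left to right, a ridge around an interior chain has a second facet in the
    ear by [admissible_star]; from right to left, [gallery] finds a ridge whose
    second facet is outside the ear. *)
Lemma ear_boundaryP C : C \in ear ->
  (C \in ball_boundary ear) <-> (forall y, tight S phi C y -> N y -> False).
Proof.
move=> Ce; split.
  rewrite inE => /existsP[F /and3P[CF /eqP cF /cards1P[H eH]]] y ty /andP[gy /eqP ky].
  have : H \in [set H in facets ear | F \subset H]%SET by rewrite eH inE.
  rewrite inE => /andP[/ear_facetP[u Nu eHu] FH]; subst H.
  have kE : #|ch u| = #|F|.+1 by rewrite cF ear_crank card_chain_of.
  have /properP[_ [A /chain_ofP[q qS eA] AF]] : F \proper ch u.
    by rewrite properEcard FH kE ltnSn.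
  have q0 : (0 < q)%N by rewrite lt0n; apply: contraNneq S0 => <-.
  have qd : (q.-1 < d)%N by apply: leq_ltn_trans (leq_pred _) (ltn_ord q).
  pose p := Ordinal qd; have e : q = p.+1 :> nat by rewrite /= prednK.
  have Fz : F \subset ch (swap u p q) by apply: sub_swap; rewrite // -eA.
  have /andP[gu /eqP ku] := Nu.
  have kz : key S (swap u p q) = key S y0 by rewrite key_swap.
  have Nz : N (swap u p q).
    rewrite /in_ear kz eqxx andbT; apply: (admissible_star phi_inj ty gy); last by rewrite ky.
    exact: fintype.subset_trans CF Fz.
  have : ch (swap u p q) \in [set H in facets ear | F \subset H]%SET.
    by rewrite inE Fz andbT; apply/ear_facetP; exists (swap u p q).
  rewrite eH inE => /eqP eqc.
  have /negP[] : swap u p q != u by apply: swap_neq; apply/eqP => /(congr1 val) /=; lia.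
  by apply/eqP/(chain_of_inj (S := S) phi_inj); rewrite ?kz ?ku ?eqc.
move=> nt; have /ear_cxP[y1 /andP[g1 /eqP k1] C1] := Ce.
have [y [p [q [e qS qC Cy [gy ky bad]]]]] : exists y (p q : 'I_d), [/\ q = p.+1 :> nat, (q : nat) \in S,
    pref phi y q \notin C, C \subset ch y & [/\ admissible S rho y, key S y = key S y1 &
    ~~ admissible S rho (swap y p q)]].
  apply: (gallery C1 g1) => y ty gy ky.
  by apply: (nt y ty); rewrite /in_ear gy ky k1 eqxx.
rewrite inE; apply/existsP; exists (ch y :\ pref phi y q); apply/and3P; split.
- apply/fintype.subsetP => A AC; rewrite !inE (fintype.subsetP Cy) // andbT.
  by apply: contraNneq qC => <-.
- by rewrite ear_crank -(card_chain_of S phi_inj y) [in X in _ == X](cardsD1 (pref phi y q)) mem_chain_of.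
- apply/cards1P; exists (ch y); apply/setP => H; rewrite finset.in_set1.
  apply/idP/eqP => [/setIdP[/ear_facetP[u /andP[gu /eqP ku] ->] sub]|->]; last first.
    apply/setIdP; split; last exact: subsetDl.
    by apply/ear_facetP; exists y; rewrite // /in_ear gy ky k1 eqxx.
  have [->//|eu] := ridge_facets phi_inj e qS (etrans ku (esym (etrans ky k1))) sub.
  by move: gu; rewrite eu (negbTE bad).
Qed.

Lemma ear_boundary_sub C : C \in ball_boundary ear -> C \in ear.
Proof.
rewrite inE => /existsP[F /and3P[CF _ /cards1P[H eH]]].
have : H \in [set H in facets ear | F \subset H]%SET by rewrite eH inE.
rewrite inE => /andP[/ear_facetP[u Nu ->] FH]; apply/ear_cxP; exists u => //.
exact: fintype.subset_trans CF FH.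
Qed.
End OneEar.

(** * The decomposition *)

Section Assembly.
Variables (R : realType) (V : finType) (d : nat) (S : pred nat).
Variables (Sigma : {set {set V}}) (t : nat).
Variables (phi : 'I_t -> 'I_d -> V) (rho : 'I_t -> nat).
Hypothesis phi_inj : forall i, injective (phi i).
Hypothesis S0 : 0%N \notin S.
Hypothesis S_lt : forall s, s \in S -> (s < d)%N.
Hypothesis t_gt0 : (0 < t)%N.
Local Notation im i := [set phi i a | a : 'I_d]%SET.
Hypothesis SigmaP : forall G : {set V}, G \in Sigma <-> exists i, G \subset im i.
Hypothesis oldP : forall i (G : {set V}), G \subset im i ->
  (exists2 j : 'I_t, (j < i)%N & G \subset im j) <->
  (exists2 a : 'I_d, (rho i <= a)%N & phi i a \notin G).
Implicit Types (y z : {perm 'I_d}) (C : {set {set V}}) (T : {set V}) (i : 'I_t) (kap : {ffun 'I_d -> nat}).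

Local Notation idp := (1%g : {perm 'I_d}).
Local Notation K := (order_complex (rank_selected Sigma S)).
Local Notation k := #|[set s : 'I_d | (s : nat) \in S]%SET|.
Let first_facet : 'I_t := Ordinal t_gt0.

Lemma K_P C : C \in K <-> (forall A, A \in C -> A \in Sigma /\ #|A| \in S) /\
  (forall A B, A \in C -> B \in C -> (A \subset B) || (B \subset A)).
Proof.
rewrite inE; split=> [/andP[/fintype.subsetP sub /forallP ch]|[h1 h2]].
  split=> [A /sub|A B hA hB]; first by rewrite inE => /andP[].
  have := ch A; rewrite hA /= => /forallP/(_ B); rewrite hB /=.
  by rewrite /Order.comparable !Order.SetSubsetOrder.leEsubset.
apply/andP; split; first by apply/fintype.subsetP => A /h1[]; rewrite inE => -> ->.
apply/forallP => A; apply/implyP => hA; apply/forallP => B; apply/implyP => hB.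
by rewrite /Order.comparable !Order.SetSubsetOrder.leEsubset h2.
Qed.

(** Which facets contain a chain then depends on a single face. *)
Lemma chain_top C : C \in K -> exists T : {set V},
  [/\ T = finset.set0 \/ T \in C, forall A, A \in C -> A \subset T & T \in Sigma].
Proof.
move=> /K_P[h1 h2]; have [A0 A0C|nex] := pickP (mem C); last first.
  exists finset.set0; split; first by left.
    by move=> A hA; have := nex A; rewrite /= hA.
  by apply/SigmaP; exists first_facet; apply: finset.sub0set.
case: (arg_maxnP (fun A : {set V} => #|A|) A0C) => T TC mx.
exists T; split; [by right| |by have [] := h1 _ TC].
move=> A hA; have /orP[//|TA] := h2 _ _ hA TC.
suff -> : T = A by [].
by apply/eqP; rewrite eqEcard TA; apply: mx.
Qed.

Lemma chain_top_im C T (j : 'I_t) : T = finset.set0 \/ T \in C ->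
  (forall A, A \in C -> A \subset T) ->
  (forall A, A \in C -> A \subset im j) <-> T \subset im j.
Proof.
move=> hT hC; split=> [h|h A /hC AT]; last exact: fintype.subset_trans AT h.
by case: hT => [->|/h//]; apply: finset.sub0set.
Qed.

(** The last letter of the tight word is the largest one outside the top of the
    chain, and it is less than [rho i] iff the restriction lies in the top. *)
Lemma tight_admissible C T i y : (forall A, A \in C -> A \subset T) ->
  T = finset.set0 \/ T \in C -> T \subset im i -> tight S (phi i) C y ->
  (admissible S (rho i) y <-> ~ exists2 j : 'I_t, (j < i)%N & T \subset im j).
Proof.
move=> hC hT Ti ty; have [Cy tyi] := ty; rewrite oldP //; split=> [/admissibleP[_ g2] [a ra aT]|nold].
  have d0 : (0 < d)%N by apply: leq_ltn_trans (ltn_ord a).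
  have pd : (d.-1 < d)%N by rewrite prednK.
  pose p := Ordinal pd; have := g2 p; rewrite /= prednK // => /(_ erefl).
  suff : (a <= y p)%N by lia.
  move: aT; have [r -> _] := posP y a => rT.
  have := ltn_ord r; rewrite -[X in (_ < X)%N](prednK d0) ltnS.
  rewrite leq_eqVlt => /orP[/eqP e|lt]; first by rewrite (_ : r = p) //; apply: val_inj.
  apply/ltnW/(tight_incr ty) => // u ru _; apply: contra rT => /hC/fintype.subsetP; apply.
  by rewrite mem_pref // pos_perm.
apply/admissibleP; split=> [p q e qS|p e].
  apply: tyi => //; apply: contra qS => /(fintype.subsetP Cy)/chain_ofP[s sS es].
  by rewrite (pref_inj (@phi_inj i) es).
rewrite ltnNge; apply/negP => le; apply: nold; exists (y p) => //.
case: hT => [->|/(fintype.subsetP Cy)/chain_ofP[s sS ->]]; first by rewrite inE.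
by rewrite mem_pref // pos_perm -leqNgt -ltnS e.
Qed.

Lemma tight_ex C i : C \in K -> (forall A, A \in C -> A \subset im i) ->
  exists y, tight S (phi i) C y.
Proof.
move=> /K_P[h1 h2] hi; apply: exists_tight => //.
by move=> A /h1[].
Qed.

Lemma chain_in_K C i y : C \subset chain_of S (phi i) y -> C \in K.
Proof.
move=> /fintype.subsetP Cy; apply/K_P; split=> [A /Cy/chain_ofP[s sS ->]|A B /Cy/chain_ofP[s _ ->] /Cy/chain_ofP[r _ ->]].
  rewrite card_pref ?(ltnW (ltn_ord s)) //; split=> //.
  by apply/SigmaP; exists i; apply: pref_sub.
by case: (leqP s r) => [h|/ltnW h]; apply/orP; [left|right]; apply/fintype.subsetP => v /imsetP[a];
  rewrite inE => lt ->; rewrite mem_pref //; apply: leq_trans h.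
Qed.

Lemma chain_sub_im C i y : C \subset chain_of S (phi i) y -> forall A, A \in C -> A \subset im i.
Proof. by move=> /fintype.subsetP Cy A /Cy/chain_ofP[s _ ->]; apply: pref_sub. Qed.

Lemma chain_first C : C \in K -> exists i y, [/\ tight S (phi i) C y, admissible S (rho i) y &
  forall j : 'I_t, (forall A, A \in C -> A \subset im j) -> (i <= j)%N].
Proof.
move=> CK; have [T [hT hC /SigmaP[i1 hi1]]] := chain_top CK.
case: (@arg_minnP _ i1 (fun i => T \subset im i) (fun i => i : nat) hi1) => i hi mn.
have [y ty] := tight_ex CK ((chain_top_im i hT hC).2 hi).
exists i, y; split=> //.
  apply/(tight_admissible hC hT hi ty) => -[j ji /mn]; by rewrite leqNgt ji.
by move=> j /(chain_top_im j hT hC) /mn.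
Qed.

(** Admissibility of the tight word forces the top of the chain to contain the
    restriction of the facet. *)
Lemma admissible_first C i y : tight S (phi i) C y -> admissible S (rho i) y ->
  forall j : 'I_t, (forall A, A \in C -> A \subset im j) -> (i <= j)%N.
Proof.
move=> ty gy j hj; have CK := chain_in_K ty.1.
have [T [hT hC _]] := chain_top CK.
have Ti := (chain_top_im i hT hC).1 (chain_sub_im ty.1).
rewrite leqNgt; apply/negP => ji.
have [] := (tight_admissible hC hT Ti ty).1 gy; exists j => //.
exact: (chain_top_im j hT hC).1 hj.
Qed.

(** The ear of a facet and a class, given by its key instead of a word. *)
Definition ear_of (e : 'I_t * {ffun 'I_d -> nat}) : {set {set {set V}}} :=
  [set C : {set {set V}} | [exists y,
    [&& admissible S (rho e.1) y, key S y == e.2 & C \subset chain_of S (phi e.1) y]]]%SET.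

Lemma ear_ofP e C : reflect (exists y, [/\ admissible S (rho e.1) y, key S y = e.2 &
  C \subset chain_of S (phi e.1) y]) (C \in ear_of e).
Proof.
rewrite inE; apply: (iffP existsP) => [[y /and3P[h1 /eqP h2 h3]]|[y [h1 h2 h3]]]; exists y.
  by split.
by rewrite h1 h2 eqxx.
Qed.

Definition before (e e' : 'I_t * {ffun 'I_d -> nat}) : bool :=
  (e.1 < e'.1)%N || ((e.1 == e'.1) && (potential e'.2 <= potential e.2)%N).

Lemma before_total : total before.
Proof.
move=> [i u] [j v]; rewrite /before /= -!val_eqE /=.
by case: (ltngtP i j) => //= _; apply: leq_total.
Qed.

Lemma before_trans : transitive before.
Proof.
move=> [j v] [i u] [l w]; rewrite /before /= -!val_eqE /=; lia.
Qed.

Definition ears : seq ('I_t * {ffun 'I_d -> nat}) :=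
  sort before (undup [seq (iy.1, key S iy.2) | iy : 'I_t * {perm 'I_d}
     <- enum [pred iy | admissible S (rho iy.1) iy.2]]).

Lemma mem_ears e : reflect (exists2 y, admissible S (rho e.1) y & key S y = e.2) (e \in ears).
Proof.
rewrite mem_sort mem_undup; apply: (iffP mapP) => [[[i y]]|[y gy ky]].
  by rewrite mem_enum inE /= => gy ->; exists y.
by exists (e.1, y); rewrite ?mem_enum ?inE //= ky; case: (e).
Qed.

Lemma ears_uniq : uniq ears. Proof. by rewrite sort_uniq undup_uniq. Qed.

Let first_key : 'I_t * {ffun 'I_d -> nat} := (first_facet, key S idp).

(** The empty face is not old in the first facet, so its restriction is empty. *)
Lemma rho0 : (d <= rho first_facet)%N.
Proof.
rewrite leqNgt; apply/negP => lt.
have [|j] := (oldP (finset.sub0set (im first_facet))).2; last by rewrite ltn0.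
by exists (Ordinal lt); rewrite ?inE /=.
Qed.

Lemma rho_lt i : i != first_facet -> (rho i < d)%N.
Proof.
move=> ne; have h : exists2 j : 'I_t, (j < i)%N & finset.set0 \subset im j.
  by exists first_facet; rewrite ?finset.sub0set //= lt0n; apply: contra ne => /eqP e; apply/eqP/val_inj.
have [a le _] := (oldP (finset.sub0set (im i))).1 h.
exact: leq_ltn_trans le (ltn_ord a).
Qed.

Lemma admissible1 : admissible S (rho first_facet) idp.
Proof.
apply/admissibleP; split=> [p q e _|p _]; rewrite !perm1 ?e //.
exact: leq_trans (ltn_ord p) rho0.
Qed.

Lemma tight1 i : tight S (phi i) finset.set0 idp.
Proof. by split=> [|p q e _]; rewrite ?finset.sub0set // !perm1 e. Qed.

Lemma first_in : first_key \in ears.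
Proof. by apply/mem_ears; exists idp => //=; apply: admissible1. Qed.

Lemma admissible1_first i y : admissible S (rho i) idp -> key S y = key S idp -> (i, key S y) = first_key.
Proof.
move=> /admissibleP[_ g] ->; congr pair; apply/eqP; apply: contraT => /rho_lt lt.
have d0 : (0 < d)%N by apply: leq_ltn_trans lt.
have pd : (d.-1 < d)%N by rewrite prednK.
have := g (Ordinal pd); rewrite perm1 /= prednK // => /(_ erefl); lia.
Qed.

Lemma before_first e : e \in ears -> before e first_key -> e = first_key.
Proof.
case: e => i kap /mem_ears[y gy /= <-]; rewrite /before /= => /andP[/eqP -> le].
have [h1 h2] := potential_tight (@phi_inj first_facet) (tight1 first_facet) (finset.sub0set (chain_of S (phi first_facet) y)).
by rewrite /first_key h2 //; apply/eqP; rewrite eqn_leq h1.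
Qed.

Let m := (size ears).-1.
Let E (j : 'I_m.+1) := ear_of (nth first_key ears j).

Lemma size_ears : size ears = m.+1.
Proof. by rewrite /m; case: (ears) first_in. Qed.

Lemma nth_ears0 : nth first_key ears 0 = first_key.
Proof.
have := nth_index first_key first_in; set l := index _ _ => el.
have [//|l0] := eqVneq l 0%N; first by move=> l0; rewrite -{2}el l0.
apply: before_first; first by rewrite mem_nth // size_ears.
rewrite -{2}el; apply: (sorted_ltn_nth before_trans); rewrite ?inE ?size_ears //.
- by apply: sort_sorted; apply: before_total.
- by rewrite -size_ears index_mem first_in.
- by rewrite lt0n.
Qed.

Lemma nth_before (j j' : nat) : (j < j')%N -> (j' < m.+1)%N ->
  before (nth first_key ears j) (nth first_key ears j').
Proof.
move=> jj jm; apply: (sorted_ltn_nth before_trans); rewrite ?inE ?size_ears //.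
- by apply: sort_sorted; apply: before_total.
- exact: ltn_trans jj jm.
Qed.

Lemma lt_index e (j : nat) : e \in ears -> (j < m.+1)%N -> ~~ before (nth first_key ears j) e ->
  (index e ears < j)%N.
Proof.
move=> ein jm nb; rewrite ltnNge; apply/negP; rewrite leq_eqVlt => /orP[/eqP ej|lt].
  move: nb; rewrite ej nth_index //.
  by have := before_total e e; rewrite orbb => ->.
have := nth_before lt; rewrite -size_ears index_mem ein nth_index // => /(_ isT).
by rewrite (negbTE nb).
Qed.

Lemma ear_rep (j : 'I_m.+1) : exists i y0, [/\ admissible S (rho i) y0,
  nth first_key ears j = (i, key S y0) & E j = ear_cx S (phi i) (rho i) y0].
Proof.
have : nth first_key ears j \in ears by rewrite mem_nth // size_ears.
case e : (nth first_key ears j) => [i kap] /mem_ears[y gy /= ky].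
by exists i, y; split=> //; rewrite ?ky // /E e /ear_cx ky.
Qed.

(** If the tight word is in the ear, its class has the highest potential among
    those that contain [C], in the first facet that contains [C].  If not, the
    tight word of [C] in that facet gives an earlier ear. *)
Lemma ear_oldP (j : 'I_m.+1) i y0 C : nth first_key ears j = (i, key S y0) -> C \in E j ->
  (exists2 j' : 'I_m.+1, (j' < j)%N & C \in E j') <->
  (forall y, tight S (phi i) C y -> in_ear S (rho i) y0 y -> False).
Proof.
move=> ej; rewrite /E ej => /ear_ofP[y1 /= [g1 k1 C1]]; split.
  move=> [j' jj' /ear_ofP[u [gu ku Cu]]] y ty /andP[gy /eqP ky].
  have := nth_before jj' (ltn_ord j); rewrite ej /before /=.
  have := admissible_first ty gy (chain_sub_im Cu).
  rewrite leq_eqVlt => /orP[/eqP/val_inj ei|lt]; last first.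
    by move=> /orP[lt'|/andP[/eqP e _]]; [have := ltn_trans lt lt' | move: lt; rewrite e]; rewrite ltnn.
  rewrite -ei ltnn eqxx /= -ku -ky => le.
  rewrite -ei in Cu; have [h1 h2] := potential_tight (@phi_inj i) ty Cu.
  have ek : key S u = key S y by apply: h2; apply/eqP; rewrite eqn_leq h1.
  have eq : nth first_key ears j' = nth first_key ears j.
    by rewrite ej -ky -ek ku ei; case: (nth first_key ears j').
  move/eqP: eq; rewrite nth_uniq ?ears_uniq ?size_ears //.
  by rewrite ltn_eqF.
move=> nt; have CK := chain_in_K C1.
have [i1 [u [tu gu mn]]] := chain_first CK.
have ein : (i1, key S u) \in ears by apply/mem_ears; exists u.
have lt : (index (i1, key S u) ears < j)%N.
  apply: lt_index => //; rewrite ej /before /= negb_or -leqNgt mn /=; last exact: chain_sub_im C1.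
  apply/negP => /andP[/eqP ei le]; move: tu gu le; rewrite -ei => tu gu le.
  apply: (nt u tu); rewrite /in_ear gu /=; rewrite -k1.
  have [h1 h2] := potential_tight (@phi_inj i) tu C1.
  by rewrite eq_sym; apply/eqP/h2/eqP; rewrite eqn_leq h1 k1.
exists (Ordinal (ltn_trans lt (ltn_ord j))) => //=.
by rewrite nth_index //; apply/ear_ofP; exists u; split=> //; apply: tu.1.
Qed.

Lemma E_cover : (\bigcup_j E j)%SET = K.
Proof.
apply/setP => C; apply/bigcupP/idP => [[j _ /ear_ofP[y [_ _ /chain_in_K]]] //|CK].
have [i [u [tu gu mn]]] := chain_first CK.
have ein : (i, key S u) \in ears by apply/mem_ears; exists u.
have lt : (index (i, key S u) ears < m.+1)%N by rewrite -size_ears index_mem.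
exists (Ordinal lt) => //; rewrite /E nth_index //.
by apply/ear_ofP; exists u; split=> //; apply: tu.1.
Qed.

Lemma K_crank : crank K = k.
Proof.
apply/eqP; rewrite eqn_leq; apply/andP; split.
  apply/bigmax_leqP => C CK; have [i [u [tu gu mn]]] := chain_first CK.
  rewrite -(card_chain_of S (@phi_inj i) u); apply: subset_leq_card tu.1.
rewrite -(card_chain_of S (@phi_inj first_facet) idp) /crank; apply: leq_bigmax_cond.
exact: (@chain_in_K _ first_facet idp).
Qed.

Let ps : 'I_k -> 'I_d := enum_val.
Let ps_inj : injective ps. Proof. exact: enum_val_inj. Qed.
Let ps_S (j : 'I_k) : (ps j : nat) \in S. Proof. by have := enum_valP j; rewrite inE. Qed.
Let ps_surj (q : 'I_d) : (q : nat) \in S -> exists j, ps j = q.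
Proof.
move=> qS; have qin : q \in [set s : 'I_d | (s : nat) \in S]%SET by rewrite inE.
by exists (enum_rank_in qin q); rewrite /ps enum_rankK_in.
Qed.

Lemma vertices_Vtx i y0 :
  {subset vertices (sphere_cx S (phi i) y0) <= [set A | Vtx S (phi i) y0 A]%SET}.
Proof.
move=> A; rewrite !inE => /existsP[y /andP[h1 h2]]; apply/existsP; exists y.
by rewrite h1 -finset.sub1set.
Qed.

Lemma ear_sub_sphere i y0 : ear_cx S (phi i) (rho i) y0 \subset sphere_cx S (phi i) y0.
Proof.
apply/fintype.subsetP => C /ear_cxP[y /andP[_ ky] Cy]; rewrite inE.
by apply/existsP; exists y; rewrite ky.
Qed.

(** A word in the class of the identity keeps the letters of a run below those of
    the later runs, hence is admissible. *)
Lemma E0_sphere : E ord0 = sphere_cx S (phi first_facet) idp.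
Proof.
rewrite /E nth_ears0; apply/setP => C; apply/ear_ofP/idP => /=.
  by move=> [y [_ /eqP ky Cy]]; rewrite inE; apply/existsP; exists y; rewrite ky.
rewrite inE => /existsP[y /andP[/eqP ky Cy]]; exists y; split=> //.
apply/admissibleP; split=> [p q e qS|p _]; last exact: leq_trans (ltn_ord _) rho0.
rewrite ltnNge; apply/negP => /(leq_run S).
have H r : run S (y r) = run S r.
  by have := key_perm S y r; rewrite ky keyE /pos invg1 perm1.
by rewrite !H (run_cut e qS) ltnn.
Qed.

Lemma E0_boundary : is_polytope_boundary R k (E ord0).
Proof.
have [P [h1 h2 h3]] := @sphere_polytope R V d S (phi first_facet) (@phi_inj first_facet) S0 idp k ps ps_inj ps_S ps_surj.
rewrite E0_sphere; exists k, P, (sphere_pt R S (phi first_facet) idp ps); split=> //.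
by move=> A B /vertices_Vtx hA /vertices_Vtx hB; apply: h2.
Qed.

(** Otherwise the identity would be an admissible word of the class, which happens
    only in the first ear; so [gallery] applies to the empty chain. *)
Lemma bad_word (j : 'I_m.+1) i y0 : j != ord0 -> nth first_key ears j = (i, key S y0) ->
  admissible S (rho i) y0 ->
  exists2 z, key S z = key S y0 & ~~ admissible S (rho i) z /\ (0 < k)%N.
Proof.
move=> j0 ej g0.
have [|y [p [q [e qS _ _ [_ ky bad]]]]] :=
  gallery (S := S) (phi := phi i) (finset.sub0set (chain_of S (phi i) y0)) g0.
  move=> y ty gy ky; have ey := tight_uniq (@phi_inj i) ty (tight1 i); subst y.
  have /eqP : nth first_key ears j = nth first_key ears 0.
    by rewrite ej nth_ears0; apply: admissible1_first.
  by rewrite nth_uniq ?ears_uniq ?size_ears // => /eqP h; case/negP: j0; apply/eqP/val_inj.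
exists (swap y p q); first by rewrite key_swap.
by split=> //; rewrite card_gt0; apply/set0Pn; exists q; rewrite inE.
Qed.

Lemma E_proper (j : 'I_m.+1) : j != ord0 -> is_proper_in_polytope_boundary R k (E j).
Proof.
move=> j0; have [i [y0 [g0 ej ->]]] := ear_rep j.
have [z kz [bad _]] := bad_word j0 ej g0.
have [P [h1 h2 h3]] := @sphere_polytope R V d S (phi i) (@phi_inj i) S0 y0 k ps ps_inj ps_S ps_surj.
have sub := fintype.subsetP (ear_sub_sphere i y0).
exists k, P, (sphere_pt R S (phi i) y0 ps); split=> //.
  have vs A : A \in vertices (ear_cx S (phi i) (rho i) y0) -> Vtx S (phi i) y0 A.
    rewrite inE => /sub h; have := @vertices_Vtx i y0 A; rewrite [_ \in vertices _]inE h inE; exact.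
  by move=> A B /vs hA /vs hB; apply: h2; rewrite inE.
rewrite -h3; split; first by move=> A [F /sub FS ->]; exists F.
move=> ss.
have zS : chain_of S (phi i) z \in sphere_cx S (phi i) y0.
  by rewrite inE; apply/existsP; exists z; rewrite kz eqxx /=.
have /ss [F Fe eF] : image_complex (sphere_pt R S (phi i) y0 ps) (sphere_cx S (phi i) y0)
  [set x | exists2 v, v \in chain_of S (phi i) z & x = sphere_pt R S (phi i) y0 ps v]%classic.
  by exists (chain_of S (phi i) z).
have vz A : A \in chain_of S (phi i) z -> A \in [set A | Vtx S (phi i) y0 A]%SET.
  by move=> Az; rewrite inE; apply/existsP; exists z; rewrite kz eqxx.
have vF A : A \in F -> A \in [set A | Vtx S (phi i) y0 A]%SET.
  move=> AF; have /ear_cxP[u /andP[_ ku] Fu] := Fe.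
  by rewrite inE; apply/existsP; exists u; rewrite ku (fintype.subsetP Fu).
have zF : chain_of S (phi i) z \subset F.
  apply/fintype.subsetP => A Az.
  have : [set x | exists2 v, v \in F & x = sphere_pt R S (phi i) y0 ps v]%classic (sphere_pt R S (phi i) y0 ps A).
    by rewrite -eF; exists A.
  by move=> [B BF /h2 ->] //; [exact: vz|exact: vF].
have /ear_cxP[u /andP[gu /eqP ku] Fu] := Fe.
have ez := chain_of_inj (S := S) (@phi_inj i) (etrans ku (esym kz)) (fintype.subset_trans zF Fu).
by move: bad; rewrite -ez gu.
Qed.

Lemma E_ball (j : 'I_m.+1) : j != ord0 -> simplicial_ball R (E j).
Proof.
move=> j0; have [i [y0 [g0 ej ->]]] := ear_rep j.
have [z kz [bad k0]] := bad_word j0 ej g0.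
pose ps' (l : 'I_k.-1.+1) := ps (cast_ord (prednK k0) l).
apply: (@ear_ball R V d S (phi i) (@phi_inj i) S0 (rho i) y0 z g0 kz bad k.-1 ps').
- by move=> a b /ps_inj/cast_ord_inj.
- by move=> l; apply: ps_S.
- move=> q /ps_surj[l <-]; exists (cast_ord (esym (prednK k0)) l).
  by rewrite /ps' cast_ordKV.
Qed.

Theorem ears_decomposition : has_convex_ear_decomposition R K.
Proof.
exists m, E; split.
- by move=> j; have [i [y0 [g0 _ ->]]] := ear_rep j; apply: ear_complex.
- exact: E_cover.
- by rewrite K_crank; apply: E0_boundary.
- move=> j j0; rewrite K_crank; split; last exact: E_proper.
  by have [i [y0 [g0 _ ->]]] := ear_rep j; apply: ear_crank.
- move=> j j0; split; first exact: E_ball.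
  have [i [y0 [g0 ej eE]]] := ear_rep j.
  apply/setP => C; rewrite finset.in_setI; apply/andP/idP => [[/bigcupP[j' jj' Cj'] Cj]|Cb].
    rewrite eE; apply/(ear_boundaryP (@phi_inj i) S0 g0); first by rewrite -eE.
    by apply/(ear_oldP ej Cj); exists j'.
  have Cj : C \in E j by rewrite eE; apply: (ear_boundary_sub (@phi_inj i)); rewrite -eE.
  split=> //; have [|j' jj' Cj'] := (ear_oldP ej Cj).2; last by apply/bigcupP; exists j'.
  by apply/(ear_boundaryP (@phi_inj i) S0 g0); rewrite -eE.
Qed.
End Assembly.

(** * From shellings to ears *)

Section ShellingData.
Variables (V : finType) (Sigma : {set {set V}}).
Implicit Types (F G : {set V}).

Lemma sub_facet G : G \in Sigma -> exists2 F, F \in facets Sigma & G \subset F.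
Proof.
move=> h; have [F mF GF] := maxset_exists (P := fun G : {set V} => G \in Sigma) h.
by exists F; rewrite ?inE.
Qed.

Lemma simplex_boundary_facet F G : G \in facets (simplex_boundary F) ->
  exists2 x, x \in F & G = F :\ x.
Proof.
rewrite inE => /maxsetP[]; rewrite !inE => /andP[GF sub] mx.
have /properP[_ [x xF xG]] : G \proper F by rewrite finset.properEneq GF.
exists x => //; apply/esym/mx.
  rewrite !inE subsetDl andbT; apply: contraTneq xF => <-; by rewrite !inE eqxx.
apply/fintype.subsetP => v vG; rewrite !inE (fintype.subsetP sub) // andbT.
by apply: contraNneq xG => <-.
Qed.

(** The restriction consists of the vertices opposite to the ridges along which
    the facet is glued. *)
Lemma shelling_restriction (s : seq {set V}) (i : nat) : (i < size s)%N ->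
  ((0 < i)%N -> exists A : {set {set V}}, [/\ A != finset.set0,
     A \subset facets (simplex_boundary (nth finset.set0 s i)) &
     (powerset (nth finset.set0 s i) :&:
        \bigcup_(j < i) powerset (nth finset.set0 s j))%SET
      = (\bigcup_(G in A) powerset G)%SET]) ->
  exists2 R : {set V}, R \subset nth finset.set0 s i &
    forall G, G \subset nth finset.set0 s i ->
     (exists2 j : 'I_(size s), (j < i)%N & G \subset nth finset.set0 s j) <->
     (exists2 x, x \in R & x \notin G).
Proof.
move=> lt; set F := nth _ _ _; case: (posnP i) => [i0 _|ip /(_ isT)[A [_ /fintype.subsetP Asub eA]]].
  exists finset.set0; first exact: finset.sub0set.
  by move=> G _; split=> [[j]|[x]]; rewrite ?inE // i0.
exists [set x in F | F :\ x \in A]%SET; first by apply/fintype.subsetP => x; rewrite inE => /andP[].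
move=> G GF; split=> [[j ji Gj]|[x]].
  have : G \in (\bigcup_(G in A) powerset G)%SET.
    rewrite -eA !inE GF /=; apply/bigcupP; exists (Ordinal ji) => //; by rewrite inE.
  move=> /bigcupP[H HA]; rewrite inE => GH; have [x xF eH] := simplex_boundary_facet (Asub _ HA).
  exists x; first by rewrite inE xF -eH.
  by apply/negP => /(fintype.subsetP GH); rewrite eH !inE eqxx.
rewrite inE => /andP[xF xA] xG.
have : G \in (\bigcup_(G in A) powerset G)%SET.
  apply/bigcupP; exists (F :\ x) => //; rewrite inE; apply/fintype.subsetP => v vG.
  rewrite !inE (fintype.subsetP GF) // andbT; by apply: contraNneq xG => <-.
rewrite -eA => /setIP[_ /bigcupP[j _]]; rewrite inE => Gj.
by exists (Ordinal (ltn_trans (ltn_ord j) lt)); rewrite /= ?ltn_ord.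
Qed.

(** Listing the vertices outside [R] before those of [R] makes [R] an upper set of
    labels. *)
Lemma labelling d F (R : {set V}) : #|F| = d -> R \subset F ->
  exists fr : ('I_d -> V) * nat, [/\ injective fr.1, [set fr.1 a | a : 'I_d]%SET = F &
    forall a : 'I_d, (fr.1 a \in R) = (fr.2 <= a)%N].
Proof.
move=> cF RF; pose l := enum (F :\: R) ++ enum R.
have sz : size l == d.
  by rewrite size_cat -!cardE -cF -(cardsID R F) (finset.setIidPr RF) addnC.
have ul : uniq l.
  rewrite cat_uniq !enum_uniq andbT /=; apply/hasPn => x; rewrite !mem_enum inE.
  by move=> ->.
have ml x : (x \in l) = (x \in F).
  rewrite mem_cat !mem_enum inE; case: (boolP (x \in R)) => [xR|xR] /=; last by rewrite orbF.
  by rewrite (fintype.subsetP RF).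
pose tl := Tuple sz.
exists (tnth tl, #|F :\: R|); split=> /=.
- move=> a b; have x0 : V := tnth tl a.
  rewrite !(tnth_nth x0) => /eqP; rewrite nth_uniq ?(eqP sz) //.
  by move=> /eqP/val_inj.
- apply/setP => x; rewrite -ml; apply/imsetP/idP => [[a _ ->]|]; first exact: mem_tnth.
  by move=> /(@tnthP _ _ tl)[a ->]; exists a.
- move=> a; have x0 : V := tnth tl a; rewrite (tnth_nth x0) /= /l nth_cat -cardE.
  case: ltnP => h; last first.
    by rewrite -mem_enum mem_nth // ltn_subLR // cardE -size_cat (eqP sz) ltn_ord.
  have : nth x0 (enum (F :\: R)) a \in F :\: R by rewrite -mem_enum mem_nth // -cardE.
  by rewrite inE => /andP[/negbTE].
Qed.
End ShellingData.

Theorem theorem6p2 (R : realType) (V : finType) (d : nat)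
    (Sigma : {set {set V}}) (S : {pred nat})
    (Sigma_complex : is_complex Sigma)
    (Sigma_dim : crank Sigma = d)
    (Sigma_pure : pure Sigma)
    (Sigma_shellable : shellable Sigma)
    (S_sub : forall s : nat, s \in S -> (1 <= s <= d - 1)%N) :
  has_convex_ear_decomposition R (order_complex (rank_selected Sigma S)).
Proof.
have [s [us es shell]] := Sigma_shellable.
have sF i : (i < size s)%N -> nth finset.set0 s i \in facets Sigma.
  by move=> lt; rewrite -es mem_nth.
have data (i : 'I_(size s)) : exists fr : ('I_d -> V) * nat, [/\ injective fr.1,
    [set fr.1 a | a : 'I_d]%SET = nth finset.set0 s i &
    forall G : {set V}, G \subset nth finset.set0 s i ->
     (exists2 j : 'I_(size s), (j < i)%N & G \subset nth finset.set0 s j) <->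
     (exists2 a : 'I_d, (fr.2 <= a)%N & fr.1 a \notin G)].
  have [|Rs Rsub RP] := @shelling_restriction V s i (ltn_ord i).
    by move=> i0; apply: shell; rewrite i0 ltn_ord.
  have cF : #|nth finset.set0 s i| = d by rewrite Sigma_pure // sF.
  have [fr [h1 h2 h3]] := labelling cF Rsub.
  exists fr; split=> // G GF; rewrite RP //; split=> [[x xR xG]|[a ra aG]].
    have : x \in [set fr.1 a | a : 'I_d]%SET by rewrite h2 (fintype.subsetP Rsub).
    by case/imsetP => a _ ex; exists a; rewrite -?ex // -h3 -ex.
  by exists (fr.1 a); rewrite ?h3.
have [f hf] := choice data.
pose phi i := (f i).1; pose rho i := (f i).2.
have im i : [set phi i a | a : 'I_d]%SET = nth finset.set0 s i by have [_] := hf i.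
apply: (@ears_decomposition R V d S Sigma (size s) phi rho).
- by move=> i; have [] := hf i.
- by apply/negP => /S_sub.
- by move=> r /S_sub; lia.
- have [F + _] := sub_facet Sigma_complex.1; rewrite -es.
  by case: (s).
- move=> G; split=> [/sub_facet[F]|[i]].
    rewrite -es => Fs GF; have lt : (index F s < size s)%N by rewrite index_mem.
    by exists (Ordinal lt); rewrite im nth_index.
  rewrite im => GF; apply: Sigma_complex.2 GF.
  by have := sF i (ltn_ord i); rewrite inE => /maxsetP[].
- move=> i G; rewrite im => GF; have [_ _ h] := hf i; rewrite -h //.
  by split=> -[j ji Gj]; exists j => //; move: Gj; rewrite im.
Qed.
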